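(* Let $\nu=\alpha-1/p$ and let $D>0$ be the number solving $D^{2\nu+2}=\sum_{j=1}^m(n_j^2\varepsilon_j^2)\wedge(n_jD)$. Assume furthermore that $\sum_{j=1}^m n_j\delta_j\to0$. Then, for any $x_0\in(0,1)$, $$\inf_{\hat f\in\mathcal M(\boldsymbol\varepsilon,\boldsymbol\delta)}\ \sup_{f\in\mathcal B^{\alpha,R}_{p,q}}\mathbb E_f\left(\hat f(x_0)-f(x_0)\right)^2\gtrsim D^{-2\nu}\wedge1.$$ Whenever $\left(\sum_{j=1}^m n_j^2\varepsilon_j^2\right)^{\frac1{2\nu+2}}\ge\max_j n_j\varepsilon_j^2$, the right-hand side is further bounded from below by $\left(\sum_{j=1}^m n_j^2\varepsilon_j^2\right)^{-\frac{2\nu}{2\nu+2}}\wedge1$.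
   Context: Data. There are $m$ servers; server $j$ holds $n_j$ observations $Z^{(j)}=(Z^{(j)}_i)_{i=1}^{n_j}$, $Z_i^{(j)}=(Y_i^{(j)},X_i^{(j)})\in\mathcal Z=\mathbb R\times[0,1]$. All $N=\sum_{j=1}^m n_j$ observations are i.i.d. from $P_f$, under which $X_i^{(j)}\sim U[0,1]$, $Y_i^{(j)}=f(X_i^{(j)})+\xi_i^{(j)}$, with $\xi_i^{(j)}\sim N(0,1)$ independent of $X_i^{(j)}$. Privacy. Server $j$ outputs a randomized transcript $T^{(j)}$ in a standard Borel space $(\mathcal T,\mathscr T)$, drawn from a conditional law $\mathbb P(\cdot\mid Z^{(j)})$ depending only on $Z^{(j)}$ (no interaction between servers). It is $(\varepsilon_j,\delta_j)$-differentially private if $\mathbb P(T^{(j)}\in A\mid Z^{(j)}=z)\le e^{\varepsilon_j}\mathbb P(T^{(j)}\in A\mid Z^{(j)}=z')+\delta_j$ for all $A\in\mathscr T$ and all $z,z'\in\mathcal Z^{n_j}$ differing in at most one of their $n_j$ entries. Here $0<\varepsilon_j\le C_\varepsilon$ for a fixed constant $C_\varepsilon>0$, and $(\boldsymbol\varepsilon,\boldsymbol\delta)=\{(\varepsilon_j,\delta_j)\}_{j=1}^m$. $\mathcal M(\boldsymbol\varepsilon,\boldsymbol\delta)$ is the class of distributed estimation protocols: transcript mechanisms, with $T^{(j)}$ being $(\varepsilon_j,\delta_j)$-differentially private for each $j$, together with an estimator $\hat f$ which is a (function-valued) function of $T=(T^{(1)},\dots,T^{(m)})$. $\mathbb E_f$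 is expectation under the joint law of data and transcripts when data are drawn from $P_f$. Function class. $p\ge2$, $q\ge1$, $\nu=\alpha-1/p>1/2$, and $R>0$ is a constant. Let $\{\psi_{lk}\}$, $l\ge l_0$, be a Cohen–Daubechies–Vial compactly supported $A$-regular orthonormal wavelet basis of $L_2[0,1]$ with $A>\alpha$ (level $l_0$ denotes the father wavelets; levels $l>l_0$ contain $2^l$ wavelets, $k=0,\dots,2^l-1$), and $f_{lk}=\langle f,\psi_{lk}\rangle$. Then $\|f\|_{\mathcal B^\alpha_{p,q}}=\big(\sum_{l\ge l_0}(2^{l(\alpha+1/2-1/p)}\|(f_{lk})_k\|_p)^q\big)^{1/q}$ (supremum over $l$ if $q=\infty$), and $\mathcal B^{\alpha,R}_{p,q}=\{f\in L_2[0,1]:\|f\|_{\mathcal B^\alpha_{p,q}}\le R\}$. Asymptotics. Statements are asymptotic in $m$, the $n_j$ and $(\boldsymbol\varepsilon,\boldsymbol\delta)$, with $N\to\infty$. $a\gtrsim b$ means $b\le Ca$ for a constant $C>0$ not depending on $m,n_j,\varepsilon_j,\delta_j$ (it may depend on the fixed quantities, such as $\alpha,p,q,R,C_\varepsilon$ and the wavelet basis). $a\wedge b=\min(a,b)$. *)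

(* Defs.v *)
From HB Require Import structures.
From mathcomp Require Import all_boot all_order all_algebra.
From mathcomp Require Import all_classical all_reals all_analysis.

Set Implicit Arguments.
Unset Strict Implicit.
Unset Printing Implicit Defensive.

Import Order.TTheory GRing.Theory Num.Theory.
Import numFieldNormedType.Exports.

Local Open Scope classical_set_scope.
Local Open Scope ring_scope.

Section wavelets.
Context {R : realType}.
Local Notation mu := (@lebesgue_measure R).
Implicit Types (phi psi g : R -> R).

Definition C_class (n : nat) g : Prop :=
  (forall i x, (i < n)%N -> derivable (derive1n i g) x 1) /\
  continuous (derive1n n g).

Definition inner01 (f g : R -> R) : R := \int[mu]_(x in `[0, 1]) (f x * g x).

Definition square_integrable01 (f : R -> R) : Prop :=
  measurable_fun (`[0, 1] : set R) f /\
  mu.-integrable `[0, 1] (fun x => (f x ^+ 2)%:E).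

(* A Daubechies father/mother pair supported in [-N+1, N], with N vanishing
   moments.  [h i] is the filter coefficient of index i - (N - 1), so the
   mother filter (-1)^k h_{1-k}, k = i - (N - 1), is read off [rev_ord i]. *)
Definition daubechies_pair (N : nat) phi psi : Prop :=
  [/\ forall x, phi x != 0 -> 1 - N%:R <= x <= N%:R,
      forall x, psi x != 0 -> 1 - N%:R <= x <= N%:R,
      \int[mu]_x phi x = 1 /\
      (forall k : int, \int[mu]_x (phi x * phi (x - k%:~R)) = (k == 0)%:R),
      exists h : 'I_(2 * N) -> R,
        (forall x, phi x = Num.sqrt 2 *
           \sum_(i < 2 * N) h i * phi (2 * x - (i%:R - (N%:R - 1)))) /\
        (forall x, psi x = Num.sqrt 2 *
           \sum_(i < 2 * N) (-1) ^+ (i + N.+1) * h (rev_ord i) *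
             phi (2 * x - (i%:R - (N%:R - 1)))) &
      forall i, (i < N)%N -> \int[mu]_x (x ^+ i * psi x) = 0].

(* On the half-line D, g is a finite linear combination of the integer
   translates of x |-> phi (c * x). *)
Definition edge_function (c : R) (D : set R) phi g : Prop :=
  exists (M : nat) (a : nat -> R), forall x, D x ->
    g x = \sum_(i < 2 * M) a i * phi (c * x - (i%:R - M%:R)).

Definition edge_functions (N : nat) (c : R) phi (gL gR : nat -> R -> R) : Prop :=
  forall k, (k < N)%N ->
    [/\ edge_function c `[0, +oo[ phi (gL k),
        edge_function c `]-oo, 0] phi (gR k),
        forall x, 2 * N%:R - 1 < x -> gL k x = 0 &
        forall x, x < - (2 * N%:R - 1) -> gR k x = 0].

(* The 2^l functions at resolution 2^-l: N left-edge functions, 2^l - 2N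
   interior translates of g, N right-edge functions. *)
Definition dilates01 (N : nat) g (gL gR : nat -> R -> R) (l k : nat) (x : R) : R :=
  Num.sqrt (2 ^+ l) *
  (if (k < N)%N then gL k (2 ^+ l * x)
   else if (k < 2 ^ l - N)%N then g (2 ^+ l * x - k%:R)
   else gR (2 ^ l - 1 - k)%N (2 ^+ l * (x - 1))).

(* Level l0 consists of the father wavelets at resolution 2^-(l0+1): the mother
   wavelets at levels l0+1, l0+2, ... complete a space of dimension 2^(l0+1). *)
Definition level_size (l0 l : nat) : nat :=
  if l == l0 then (2 ^ l0.+1)%N else (2 ^ l)%N.

(* Cohen-Daubechies-Vial basis of L_2[0,1]; A-regular means that the generating
   pair is of class C^A with at least A vanishing moments.  Edge functions
   inherit the smoothness, being combinations of dilated translates of phi. *)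
Definition cdv_basis (A l0 : nat) (w : nat -> nat -> R -> R) : Prop :=
  exists (N : nat) (phi psi : R -> R) (phiL phiR psiL psiR : nat -> R -> R),
  [/\ [/\ (A <= N)%N, (2 * N <= 2 ^ l0.+1)%N, C_class A phi, C_class A psi &
          daubechies_pair N phi psi],
      edge_functions N 1 phi phiL phiR /\ edge_functions N 2 phi psiL psiR,
      (forall k x, (k < 2 ^ l0.+1)%N -> 0 <= x <= 1 ->
         w l0 k x = dilates01 N phi phiL phiR l0.+1 k x) /\
      (forall l k x, (l0 < l)%N -> (k < 2 ^ l)%N -> 0 <= x <= 1 ->
         w l k x = dilates01 N psi psiL psiR l k x),
      forall l k i, (l0 < l)%N -> (k < 2 ^ l)%N -> (i < N)%N ->
        inner01 (fun x => x ^+ i) (w l k) = 0 &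
      (forall l k l' k', (l0 <= l)%N -> (k < level_size l0 l)%N ->
         (l0 <= l')%N -> (k' < level_size l0 l')%N ->
         inner01 (w l k) (w l' k') = ((l == l') && (k == k'))%:R) /\
      (forall f, square_integrable01 f ->
         (forall l k, (l0 <= l)%N -> (k < level_size l0 l)%N ->
            inner01 f (w l k) = 0) ->
         {ae mu, forall x, 0 <= x <= 1 -> f x = 0})].

End wavelets.

Section besov.
Context {R : realType}.

Definition inv_exponent (p : \bar R) : R := if p is r%:E then r^-1 else 0.

Definition lp_norm (p : \bar R) (n : nat) (v : 'I_n -> R) : R :=
  if p is r%:E then (\sum_(k < n) `|v k| `^ r) `^ r^-1
  else \big[Num.max/0]_(k < n) `|v k|.

Definition besov_norm (alpha : R) (p q : \bar R) (l0 : nat)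
    (w : nat -> nat -> R -> R) (f : R -> R) : \bar R :=
  let b l := 2 `^ (l%:R * (alpha + 2^-1 - inv_exponent p)) *
    lp_norm p (fun k : 'I_(level_size l0 l) => inner01 f (w l k)) in
  if q is r%:E then poweR (\sum_(l0 <= l <oo) (b l `^ r)%:E)%E r^-1
  else ereal_sup [set (b l)%:E | l in [set l | (l0 <= l)%N]].

(* For alpha > 1/p the elements of the Besov ball have continuous
   representatives; these are the ones whose point values f(x0) are meant.
   Only the values on [0,1] matter. *)
Definition besov_ball (alpha : R) (p q : \bar R) (radius : R) (l0 : nat)
    (w : nat -> nat -> R -> R) : set {mfun R >-> R} :=
  [set f : {mfun R >-> R} | [/\ {within `[0, 1], continuous f},
     square_integrable01 f &
     (besov_norm alpha p q l0 w f <= radius%:E)%E]].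

End besov.

(* Values (y, x) of one observation Z = (Y, X). *)
Notation sample R := (measurableTypeR R * measurableTypeR R)%type.

Section regression_model.
Context {R : realType}.

(* From the pair (covariate, noise) to the observation. *)
Definition observe (f : {mfun R >-> R}) (u : sample R) : sample R :=
  (f u.1 + (u.2 : R), u.1).

Lemma measurable_observe (f : {mfun R >-> R}) :
  measurable_fun [set: sample R] (observe f).
Proof.
apply/measurable_fun_pairP; split; last exact: measurable_fst.
apply: (@measurable_realfun.measurable_funD _ _ R); last exact: measurable_snd.
exact: (measurableT_comp (measurable_funPT f) measurable_fst).
Qed.

HB.instance Definition _ (f : {mfun R >-> R}) :=
  isMeasurableFun.Build _ _ _ _ (observe f) (measurable_observe f).

(* P_f *)
Definition obs_law (f : {mfun R >-> R}) : probability (sample R) R :=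
  distribution (uniform_prob (@ltr01 R) \x normal_prob 0 1)%E (observe f).

End regression_model.

Section product_law.
Context d (T : measurableType d) {R : realType}.

Definition cons_pair (n : nat) (u : T * n.-tuple T) : n.+1.-tuple T :=
  [the n.+1.-tuple T of u.1 :: u.2].

Lemma measurable_cons_pair (n : nat) :
  measurable_fun [set: T * n.-tuple T] (@cons_pair n).
Proof.
exact: measurable_cons measurable_fst measurable_snd.
Qed.

HB.instance Definition _ (n : nat) :=
  isMeasurableFun.Build _ _ _ _ (@cons_pair n) (@measurable_cons_pair n).

Fixpoint product_law (n : nat) : ('I_n -> probability T R) ->
    probability (n.-tuple T) R :=
  match n with
  | 0 => fun=> \d_([tuple] : 0.-tuple T)
  | n'.+1 => fun P =>
      distribution (P ord0 \x product_law (fun i => P (lift ord0 i)))%E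
        (@cons_pair n')
  end.

End product_law.

Definition standard_borel (R : realType) d (T : measurableType d) : Prop :=
  exists (U : completePseudoMetricType R) (h : T -> U),
  [/\ hausdorff_space U,
      exists2 S : set U, countable S & dense S,
      bijective h &
      forall A : set T, measurable A <-> <<s @open U >> (h @` A)].

Record design (R : realType) := Design {
  servers : nat ;
  nobs : 'I_servers -> nat ;
  eps : 'I_servers -> R ;
  delta : 'I_servers -> R }.

Section protocols.
Context {R : realType}.

Definition total_obs (S : design R) : nat := (\sum_(j < servers S) nobs j)%N.

(* Mechanisms are Markov kernels on (R x R)^n; the privacy constraint concerns
   data sets with covariates in [0,1], which carry all the mass. *)
Definition in_sample_space (n : nat) (z : n.-tuple (sample R)) : Prop :=
  forall i, 0 <= ((tnth z i).2 : R) <= 1.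

Definition neighbours (n : nat) (z z' : n.-tuple (sample R)) : Prop :=
  (#|[set i : 'I_n | tnth z i != tnth z' i]%SET| <= 1)%N.

Definition differentially_private (e de : R) (n : nat) d (T : measurableType d)
    (K : n.-tuple (sample R) -> pprobability T R) : Prop :=
  forall z z', in_sample_space z -> in_sample_space z' -> neighbours z z' ->
  forall B, measurable B -> (K z B <= (expR e)%:E * K z' B + de%:E)%E.

Record protocol (S : design R) := Protocol {
  transcript_display : measure_display ;
  transcript : measurableType transcript_display ;
  transcript_borel : standard_borel R transcript ;
  mechanism : forall j : 'I_(servers S),
    {mfun (nobs j).-tuple (sample R) >-> pprobability transcript R} ;
  mechanism_private : forall j : 'I_(servers S),
    differentially_private (eps j) (delta j) (mechanism j) ;
  estimator : (servers S).-tuple transcript -> R -> R ;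
  measurable_estimator : forall x, 0 <= x <= 1 ->
    measurable_fun [set: (servers S).-tuple transcript] (estimator ^~ x) }.
Arguments estimator {S} _ _ _.

Definition server_data (S : design R) (z : (total_obs S).-tuple (sample R))
    (j : 'I_(servers S)) : (nobs j).-tuple (sample R) :=
  [tuple tnth z (tagnat.Rank j i) | i < nobs j].

(* E_f (fhat(x) - f(x))^2: the total_obs S observations are i.i.d. from
   obs_law f and, given them, the transcripts are independent, the j-th one
   being drawn from the j-th mechanism at the data of server j. *)
Definition risk (S : design R) (P : protocol S) (x : R) (f : {mfun R >-> R}) :
    \bar R :=
  (\int[product_law (fun _ : 'I_(total_obs S) => obs_law f)]_z
   \int[product_law (fun j : 'I_(servers S) =>
          mechanism P j (server_data z j) : probability _ R)]_t
     ((estimator P t x - f x) ^+ 2)%:E)%E.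

Definition minimax_risk (S : design R) (F : set {mfun R >-> R}) (x : R) :
    \bar R :=
  ereal_inf [set r | exists P : protocol S,
    r = ereal_sup [set risk P x f | f in F]].

End protocols.

(* Main.v *)
Require Import Defs.
From HB Require Import structures.
From mathcomp Require Import all_boot all_order all_algebra.
From mathcomp Require Import all_classical all_reals all_analysis.
From mathcomp Require Import measurable_realfun giry.
From mathcomp Require Import ring lra zify.

Set Implicit Arguments.
Unset Strict Implicit.
Unset Printing Implicit Defensive.

Import Order.TTheory GRing.Theory Num.Theory.
Import numFieldNormedType.Exports.

Local Open Scope classical_set_scope.
Local Open Scope ring_scope.

(** Le Cam's two-point method with [f = 0] and [f = kappa h^nu phi(./h - k)], a
    dilated father wavelet of bandwidth [h = 2^-L] of order [1/D], [L] large. It is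
    orthogonal to all wavelets of level at least [L], so its Besov norm is controlled
    by Bessel's inequality, and for every [x0] some integer translate [k] keeps
    [|phi(x0/h - k)|] bounded below.

    The two laws of a transcript are compared through the functional inequality
    [E_1 u <= sqrt (k E_0 u^2) + e] for [0 <= u <= 1], which is inherited by products
    (the [k] multiply, the [e] add up) and by Markov kernels. A server may be bounded
    in two ways. By Cauchy-Schwarz against the Gaussian likelihood ratio, [log k] is of
    order [n h^(2 nu + 1)]. By privacy, replacing the observations one at a time gives
    [E_1 u <= (1 + s) E_0 u + O(n delta)] and conversely, with [s] of order
    [n eps h^(nu + 1)], hence [k = 1 + s^2]. Taking the better bound for each server,
    the equation defining [D] makes the product of the [k] bounded. *)

(** * Bounded functions and their means *)

(** With [h = 1/D], dividing the equation for [D] by [D^(2 nu + 2)] says that the sum over the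
    servers of the smaller of [(n eps h^(nu + 1))^2] and [n h^(2 nu + 1)] equals 1. These are the
    orders of [s^2] and of the Gaussian [log k], so the minimum in the statement is the choice
    between the two bounds, made server by server. The Gaussian bound pays the squared amplitude
    [h^(2 nu)] times the probability [h] that a covariate meets the bump. The private bound is built
    on total variation, which pays the amplitude only to the first power, but it gains a factor
    [eps]. Each term of the sum is also at most 1, so [n eps h^(nu + 1)] is bounded at every server
    treated as private. This is what allows the [n]-fold product of factors [1 + O(eps h^(nu + 1))]
    to be replaced by [1 + s] with [s] linear in [n eps h^(nu + 1)]. When [D] is bounded, the
    bandwidth stays at a fixed largest admissible value [2^-L0], and the minimum with 1 takes over.
    Since [p >= 2], an [l_p] norm is at most the [l_2] norm, so Bessel's inequality is enough at
    each level. *)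

Definition bounded_measurable d (T : measurableType d) (R : realType)
    (f : T -> R) :=
  measurable_fun setT f /\ exists M, forall x, `|f x| <= M.

(** These are randomized tests. The class is stable under sections, under averaging over one
    coordinate and under kernels, and its members are integrable for every probability, so means can
    be computed in the reals. *)
Definition unit_valued d (T : measurableType d) (R : realType) (f : T -> R) :=
  measurable_fun setT f /\ forall x, 0 <= f x <= 1.

Section bounded_measurable_theory.
Context d (T : measurableType d) (R : realType).
Implicit Types (mu : probability T R) (f g : T -> R).

Lemma unit_valued_bounded f : unit_valued f -> bounded_measurable f.
Proof.
move=> [mf f01]; split => //; exists 1 => x.
by have /andP[f0 f1] := f01 x; rewrite ger0_norm.
Qed.

Lemma bounded_measurable_cst (c : R) : bounded_measurable (fun _ : T => c).
Proof. by split => //; exists `|c|. Qed.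

Lemma bounded_measurableD f g : bounded_measurable f -> bounded_measurable g ->
  bounded_measurable (fun x => f x + g x).
Proof.
move=> [mf [M fM]] [mg [N gN]]; split; first exact: measurable_funD.
by exists (M + N) => x; rewrite (le_trans (ler_normD _ _))// lerD.
Qed.

Lemma bounded_measurableM f g : bounded_measurable f -> bounded_measurable g ->
  bounded_measurable (fun x => f x * g x).
Proof.
move=> [mf [M fM]] [mg [N gN]]; split; first exact: measurable_funM.
by exists (M * N) => x; rewrite normrM ler_pM.
Qed.

Lemma bounded_measurableZ (c : R) f : bounded_measurable f ->
  bounded_measurable (fun x => c * f x).
Proof. by apply: bounded_measurableM; exact: bounded_measurable_cst. Qed.

Lemma bounded_measurableB f g : bounded_measurable f -> bounded_measurable g ->
  bounded_measurable (fun x => f x - g x).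
Proof.
move=> mf mg; under eq_fun do rewrite -mulN1r.
by apply: bounded_measurableD => //; exact: bounded_measurableZ.
Qed.

Lemma bounded_measurableX f n : bounded_measurable f ->
  bounded_measurable (fun x => f x ^+ n).
Proof.
move=> [mf [M fM]]; split; first exact: measurable_funX.
by exists (M ^+ n) => x; rewrite normrX lerXn2r ?nnegrE// (le_trans _ (fM x)).
Qed.

Lemma bounded_measurable_norm f : bounded_measurable f ->
  bounded_measurable (fun x => `|f x|).
Proof.
move=> [mf [M fM]]; split; first exact: measurableT_comp.
by exists M => x; rewrite normr_id.
Qed.

Lemma bounded_measurable_integrable mu f : bounded_measurable f ->
  mu.-integrable setT (EFin \o f).
Proof.
move=> [mf [M fM]]; apply: measurable_bounded_integrable => //.
  by rewrite (le_lt_trans (probability_le1 mu measurableT))// ltry.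
by exists M; split; [exact: num_real|move=> N MN x _; rewrite /= (le_trans (fM x)) // ltW].
Qed.

Lemma mean_cst mu (c : R) : \int[mu]_x c = c.
Proof. by rewrite Rintegral_cst//= (@probability_setT _ _ _ mu) mulr1. Qed.

Lemma meanD mu f g : bounded_measurable f -> bounded_measurable g ->
  \int[mu]_x (f x + g x) = \int[mu]_x f x + \int[mu]_x g x.
Proof. by move=> mf mg; rewrite RintegralD//; exact: bounded_measurable_integrable. Qed.

Lemma meanB mu f g : bounded_measurable f -> bounded_measurable g ->
  \int[mu]_x (f x - g x) = \int[mu]_x f x - \int[mu]_x g x.
Proof. by move=> mf mg; rewrite RintegralB//; exact: bounded_measurable_integrable. Qed.

Lemma meanZ mu (c : R) f : bounded_measurable f ->
  \int[mu]_x (c * f x) = c * \int[mu]_x f x.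
Proof. by move=> mf; rewrite RintegralZl//; exact: bounded_measurable_integrable. Qed.

Lemma le_mean mu f g : bounded_measurable f -> bounded_measurable g ->
  (forall x, f x <= g x) -> \int[mu]_x f x <= \int[mu]_x g x.
Proof. by move=> mf mg fg; apply: le_Rintegral => //; exact: bounded_measurable_integrable. Qed.

Lemma EFin_mean mu f : bounded_measurable f ->
  (\int[mu]_x f x)%:E = (\int[mu]_x (f x)%:E)%E.
Proof.
move=> mf; rewrite /Rintegral fineK//.
by apply: integrable_fin_num => //; exact: bounded_measurable_integrable.
Qed.

Lemma mean_unit_valued mu f : unit_valued f -> 0 <= \int[mu]_x f x <= 1.
Proof.
move=> uf; have bf := unit_valued_bounded uf; case: uf => mf f01.
apply/andP; split.
  by apply: Rintegral_ge0 => x _; have /andP[] := f01 x.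
rewrite -[leRHS](mean_cst mu); apply: le_mean => //.
  exact: bounded_measurable_cst.
by move=> x; have /andP[] := f01 x.
Qed.

(** Integrate [(f - a)^2 >= 0] with [a] the mean of [f]. *)
Lemma sqr_mean_le mu f : bounded_measurable f ->
  (\int[mu]_x f x) ^+ 2 <= \int[mu]_x (f x ^+ 2).
Proof.
move=> bf; set a := \int[mu]_x f x.
have h : \int[mu]_x (2 * a * f x) <= \int[mu]_x (f x ^+ 2 + a ^+ 2).
  apply: le_mean; first exact: bounded_measurableZ.
    apply: bounded_measurableD; first exact: bounded_measurableX.
    exact: bounded_measurable_cst.
  by move=> x; have := sqr_ge0 (f x - a); lra.
move: h; rewrite meanZ// meanD ?mean_cst//; last 2 first.
  exact: bounded_measurableX.
  exact: bounded_measurable_cst.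
by rewrite -/a; lra.
Qed.

End bounded_measurable_theory.
#[global] Hint Resolve unit_valued_bounded : core.

Section unit_valued_theory.
Context d (T : measurableType d) (R : realType).
Implicit Types (f g : T -> R).

Lemma unit_valued_sqr f : unit_valued f -> unit_valued (fun x => f x ^+ 2).
Proof.
move=> [mf f01]; split; first exact: measurable_funX.
by move=> x; have /andP[f0 f1] := f01 x; rewrite sqr_ge0 expr_le1.
Qed.

Lemma unit_valuedC f : unit_valued f -> unit_valued (fun x => 1 - f x).
Proof.
move=> [mf f01]; split; first by apply: measurable_funB.
by move=> x; have /andP[f0 f1] := f01 x; rewrite subr_ge0 f1 gerBl.
Qed.

End unit_valued_theory.

Section mean_product.
Context d d' (T : measurableType d) (U : measurableType d') (R : realType).
Implicit Types (P : probability T R) (Q : probability U R) (f : T * U -> R).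

Lemma unit_valued_section1 f x : unit_valued f -> unit_valued (fun y => f (x, y)).
Proof.
move=> [mf f01]; split => //.
by apply: (measurableT_comp mf); exact: measurable_pair1.
Qed.

Lemma unit_valued_section2 f y : unit_valued f -> unit_valued (fun x => f (x, y)).
Proof.
move=> [mf f01]; split => //.
by apply: (measurableT_comp mf); exact: measurable_pair2.
Qed.

Lemma unit_valued_mean Q f : unit_valued f ->
  unit_valued (fun x => \int[Q]_y f (x, y)).
Proof.
move=> uf; split; last by move=> x; apply: mean_unit_valued; exact: unit_valued_section1.
apply/measurable_EFinP; rewrite (_ : _ \o _ = fun x => (\int[Q]_y (f (x, y))%:E)%E).
  apply: (@measurable_fun_fubini_tonelli_F _ _ _ _ _ Q (EFin \o f)) => /=.
  - by apply/measurable_EFinP; case: uf.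
  - by move=> z; rewrite lee_fin; case: uf => _ /(_ z)/andP[].
apply/funext => x /=; rewrite EFin_mean//.
exact/unit_valued_bounded/unit_valued_section1.
Qed.

Lemma mean_prod P Q f : unit_valued f ->
  \int[(P \x Q)%E]_z f z = \int[P]_x \int[Q]_y f (x, y).
Proof.
move=> uf; apply: EFin_inj; rewrite !EFin_mean//; last 2 first.
  exact/unit_valued_bounded.
  exact/unit_valued_bounded/unit_valued_mean.
rewrite fubini_tonelli1//=; last 2 first.
  by apply/measurable_EFinP; case: uf.
  by move=> z; rewrite lee_fin; case: uf => _ /(_ z)/andP[].
apply: eq_integral => x _; rewrite EFin_mean//.
exact/unit_valued_bounded/unit_valued_section1.
Qed.

End mean_product.

(** * A dual form of chi-square bounds *)

Section chi2_domination.
Context d (T : measurableType d) (R : realType).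
Implicit Types (mu nu : probability T R) (u : T -> R).

(* A dual form of [\int (d nu / d mu)^2 <= k] up to an additive error [e]; unlike
   densities, it passes to products and kernels without Radon-Nikodym. *)
Definition chi2_dominated mu nu (k e : R) := forall u, unit_valued u ->
  \int[nu]_x u x <= Num.sqrt (k * \int[mu]_x (u x ^+ 2)) + e.

Lemma unit_valued_pos u (a : R) : 0 <= a -> unit_valued u ->
  unit_valued (fun x => Num.max (u x - a) 0).
Proof.
move=> a0 [mu u01]; split.
  by apply: measurable_maxr => //; exact: measurable_funB.
by move=> x; have /andP[] := u01 x; rewrite le_max lexx orbT ge_max ler01; lra.
Qed.

(** Split [u = a + up - un] around its [mu]-mean [a]; the two parts then have the same [mu]-mean
    [m]. The hypotheses, used for [up] in one direction and for [un] in the other, bound the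
    [nu]-mean of [u] by [a + s (2 m) + 2 e]. Since [|u - a|] has mean [2 m], the variance of [u] is
    at least [(2 m)^2], and Cauchy-Schwarz in the plane applied to [(1, s)] and [(a, 2 m)]
    concludes. The square of [s] thus appears although the hypotheses are linear in [s]. *)
Lemma chi2_dominated_close mu nu (s e : R) : 0 <= s ->
  (forall u, unit_valued u ->
    \int[nu]_x u x <= (1 + s) * \int[mu]_x u x + e) ->
  (forall u, unit_valued u ->
    \int[mu]_x u x <= (1 + s) * \int[nu]_x u x + e) ->
  chi2_dominated mu nu (1 + s ^+ 2) (2 * e).
Proof.
move=> s0 H1 H2 u uu.
have bu := unit_valued_bounded uu.
set a := \int[mu]_x u x.
have /andP[a0 a1] : 0 <= a <= 1 := mean_unit_valued mu uu.
pose up := fun x => Num.max (u x - a) 0.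
pose un := fun x => Num.max (a - u x) 0.
have uup : unit_valued up by exact: unit_valued_pos.
have uun : unit_valued un.
  have := unit_valued_pos (_ : 0 <= 1 - a) (unit_valuedC uu).
  rewrite subr_ge0 => /(_ a1); congr unit_valued.
  by apply/funext => x; rewrite /un; congr Num.max; lra.
have bup := unit_valued_bounded uup.
have bun := unit_valued_bounded uun.
have bB := bounded_measurableB bup bun.
have uE x : u x = a + (up x - un x).
  by rewrite /up /un; case: (leP (u x - a) 0); case: (leP (a - u x) 0); lra.
have meanE (P : probability T R) : \int[P]_x u x = a + (\int[P]_x up x - \int[P]_x un x).
  transitivity (\int[P]_x (a + (up x - un x))).
    by apply: eq_Rintegral => x _; exact: uE.
  by rewrite (meanD P (bounded_measurable_cst T a) bB) mean_cst meanB.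
have e1 : \int[mu]_x up x = \int[mu]_x un x.
  by have := meanE mu; rewrite -/a; lra.
have /andP[n0 _] := mean_unit_valued mu uun.
have /andP[n0' _] := mean_unit_valued nu uun.
set m := \int[mu]_x un x in e1 n0.
have h1 := H1 _ uup.
have h2 := H2 _ uun.
(* Follows from [m <= (1 + s) n + e] and [(1 - s)(1 + s) <= 1], [n] being the mean on the right; the
   test 0 shows [0 <= e]. *)
have h3 : (1 - s) * m - e <= \int[nu]_x un x.
  have e0 : 0 <= e.
    have u0 : unit_valued (fun _ : T => 0 : R).
      by split => // x; rewrite lexx ler01.
    by have := H1 _ u0; rewrite !mean_cst; lra.
  by rewrite -/m in h2; nra.
have h4 : (2 * m) ^+ 2 <= \int[mu]_x (u x ^+ 2) - a ^+ 2.
  have -> : 2 * m = \int[mu]_x (up x + un x) by rewrite meanD// e1 -/m; lra.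
  apply: le_trans (sqr_mean_le mu _) _; first exact: bounded_measurableD.
  have <- : \int[mu]_x ((u x ^+ 2 - 2 * a * u x) + a ^+ 2) =
      \int[mu]_x (u x ^+ 2) - a ^+ 2.
    rewrite meanD ?mean_cst ?meanB ?meanZ -/a; try lra.
    - exact: bu.
    - exact: bounded_measurableX.
    - exact: bounded_measurableZ.
    - apply: bounded_measurableB; first exact: bounded_measurableX.
      exact: bounded_measurableZ.
    - exact: bounded_measurable_cst.
  apply: le_mean.
  - by apply: bounded_measurableX; exact: bounded_measurableD.
  - apply: bounded_measurableD; last exact: bounded_measurable_cst.
    apply: bounded_measurableB; first exact: bounded_measurableX.
    exact: bounded_measurableZ.
  - move=> x; rewrite /up /un.
    by case: (leP (u x - a) 0); case: (leP (a - u x) 0); nra.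
have h5 : a + s * (2 * m) <= Num.sqrt ((1 + s ^+ 2) * \int[mu]_x (u x ^+ 2)).
  rewrite -[leLHS]ger0_norm ?addr_ge0 ?mulr_ge0// -sqrtr_sqr ler_wsqrtr//.
  have := sqr_ge0 (s * a - 2 * m); have := sqr_ge0 s; nra.
rewrite meanE; rewrite e1 in h1; lra.
Qed.

End chi2_domination.

Section chi2_product.
Context d d' (T : measurableType d) (U : measurableType d') (R : realType).

(** The second domination, used at fixed [x], bounds the inner mean by a function of [x], to which
    the first domination is then applied. *)
Lemma chi2_dominated_prod (mu nu : probability T R) (mu' nu' : probability U R)
    (k e k' e' : R) : 0 <= k -> 0 <= k' -> 0 <= e' ->
  chi2_dominated mu nu k e -> chi2_dominated mu' nu' k' e' ->
  chi2_dominated (mu \x mu')%E (nu \x nu')%E (k * k') (e + e').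
Proof.
move=> k0 k0' e0' H H' u uu.
have uu2 := unit_valued_sqr uu.
rewrite !mean_prod//.
pose v x := \int[mu']_y (u (x, y) ^+ 2).
have uv : unit_valued v by exact: (unit_valued_mean mu' uu2).
(* Truncation at 1 makes [w] a legitimate test for the outer domination. It costs nothing, the inner
   mean being at most 1. *)
pose w x := Num.min (Num.sqrt (k' * v x)) 1.
have w0 x : 0 <= w x by rewrite /w le_min sqrtr_ge0 ler01.
have uw : unit_valued w.
  split; last by move=> x; rewrite w0 /w ge_min lexx orbT.
  apply: measurable_minr => //.
  apply: measurableT_comp; last by apply: measurable_funM => //; case: uv.
  exact: continuous_measurable_fun (@sqrt_continuous R).
have h1 : \int[nu]_x \int[nu']_y u (x, y) <= \int[nu]_x (w x + e').
  apply: le_mean.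
  - exact/unit_valued_bounded/unit_valued_mean.
  - apply: bounded_measurableD; last exact: bounded_measurable_cst.
    exact: unit_valued_bounded.
  move=> x; have ux := unit_valued_section1 x uu.
  rewrite /w; case: (leP (Num.sqrt _) 1) => _; first exact: H'.
  by have /andP[_ h] := mean_unit_valued nu' ux; rewrite (le_trans h)// lerDl.
apply: (le_trans h1); rewrite meanD ?mean_cst; last 2 first.
- exact: unit_valued_bounded.
- exact: bounded_measurable_cst.
rewrite addrA lerD2r (le_trans (H _ uw))// lerD2r ler_wsqrtr//.
rewrite -mulrA ler_wpM2l// -[leRHS]meanZ; last exact: unit_valued_bounded.
apply: le_mean.
- by apply: bounded_measurableX; exact: unit_valued_bounded.
- by apply: bounded_measurableZ; exact: unit_valued_bounded.
move=> x; have v0 : 0 <= v x by case: uv => _ /(_ x)/andP[].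
rewrite -[leRHS]sqr_sqrtr ?mulr_ge0//.
by rewrite lerXn2r ?nnegrE ?sqrtr_ge0// /w ge_min lexx.
Qed.

End chi2_product.

Section mean_distribution.
Context d d' (T : measurableType d) (U : measurableType d') (R : realType).

Lemma mean_distribution (P : probability T R) (X : {mfun T >-> U}) (u : U -> R) :
  unit_valued u -> \int[distribution P X]_y u y = \int[P]_x u (X x).
Proof.
move=> uu; congr fine; rewrite ge0_integral_distribution//=.
  by apply/measurable_EFinP; case: uu.
by move=> x; rewrite lee_fin; case: uu => _ /(_ x)/andP[].
Qed.

Lemma unit_valued_comp (X : T -> U) (u : U -> R) :
  measurable_fun setT X -> unit_valued u -> unit_valued (u \o X).
Proof.
move=> mX [mu u01]; split; first exact: measurableT_comp.
by move=> x; exact: u01.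
Qed.

End mean_distribution.

Section product_law_mean.
Context d (T : measurableType d) (R : realType).

Lemma mean_product_lawS n (P : 'I_n.+1 -> probability T R)
    (u : n.+1.-tuple T -> R) : unit_valued u ->
  \int[product_law P]_t u t =
  \int[P ord0]_x \int[product_law (fun i => P (lift ord0 i))]_s
     u (cons_pair (x, s)).
Proof.
move=> uu; rewrite /= mean_distribution//.
rewrite (@mean_prod _ _ _ _ _ _ _ (u \o @cons_pair _ _ n))//.
by apply: unit_valued_comp => //; exact: measurable_cons_pair.
Qed.

Lemma mean_product_law0 (P : 'I_0 -> probability T R) (u : 0.-tuple T -> R) :
  measurable_fun setT u -> \int[product_law P]_t u t = u [tuple].
Proof.
move=> mu; rewrite /Rintegral /= integral_dirac//=; last exact/measurable_EFinP.
by rewrite indicT mul1r.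
Qed.

Lemma chi2_dominated_product_law n (P Q : 'I_n -> probability T R)
    (k e : 'I_n -> R) : (forall i, 0 <= k i) -> (forall i, 0 <= e i) ->
  (forall i, chi2_dominated (P i) (Q i) (k i) (e i)) ->
  chi2_dominated (product_law P) (product_law Q) (\prod_i k i) (\sum_i e i).
Proof.
elim: n P Q k e => [|n IH] P Q k e k0 e0 H u uu.
  have [mu u01] := uu; have /andP[u0 _] := u01 [tuple].
  rewrite big_ord0 big_ord0 mul1r addr0 !mean_product_law0//.
    by rewrite sqrtr_sqr ger0_norm.
  exact: measurable_funX.
have uc := unit_valued_comp (@measurable_cons_pair _ T n) uu.
rewrite !big_ord_recl.
have k'0 : 0 <= \prod_i k (lift ord0 i) by apply: prodr_ge0.
have e'0 : 0 <= \sum_i e (lift ord0 i) by apply: sumr_ge0.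
have H' := IH _ _ _ _ (fun i => k0 (lift ord0 i)) (fun i => e0 (lift ord0 i))
  (fun i => H (lift ord0 i)).
have := chi2_dominated_prod (k0 ord0) k'0 e'0 (H ord0) H' uc.
by rewrite /= !mean_distribution//; exact: unit_valued_sqr.
Qed.

End product_law_mean.

(** * Mixtures by a Markov kernel *)

Section setwise_to_mean.
Context d (T : measurableType d) (R : realType).
Implicit Types (mu nu : probability T R) (u : T -> R).

Lemma mean_prod2 d' (U : measurableType d') (P : probability T R)
    (Q : probability U R) (f : T * U -> R) : unit_valued f ->
  \int[(P \x Q)%E]_z f z = \int[Q]_y \int[P]_x f (x, y).
Proof.
move=> uf; have uswap : unit_valued (f \o (fun z : U * T => (z.2, z.1))).
  by apply: unit_valued_comp => //; exact: measurable_fun_pair.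
apply: EFin_inj; rewrite !EFin_mean//; last 2 first.
  exact/unit_valued_bounded.
  exact/unit_valued_bounded/(unit_valued_mean P uswap).
rewrite fubini_tonelli2//=; last 2 first.
  by apply/measurable_EFinP; case: uf.
  by move=> z; rewrite lee_fin; case: uf => _ /(_ z)/andP[].
apply: eq_integral => y _; rewrite EFin_mean//.
exact/unit_valued_bounded/unit_valued_section2.
Qed.

Lemma mean_indicator mu (A : set T) : measurable A ->
  \int[mu]_x (\1_A x : R) = fine (mu A).
Proof. by move=> mA; rewrite /Rintegral integral_indic// setIT. Qed.

Lemma unit_valued_bool d' (U : measurableType d') (b : U -> bool) :
  measurable_fun setT b -> unit_valued (fun x => (b x)%:R : R).
Proof.
move=> mb; split; last by move=> x; case: (b x); rewrite ?lexx ?ler01.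
rewrite (_ : (fun _ => _) = fun x => if b x then 1 else 0); last first.
  by apply/funext => x; case: (b x).
exact: measurable_fun_ifT.
Qed.

Lemma uniform_prob_lt (a : R) : 0 <= a <= 1 ->
  \int[uniform_prob (@ltr01 R)]_r ((r < a)%R%:R : R) = a.
Proof.
move=> /andP[a0 a1]; rewrite /Rintegral integral_uniform//; last first.
  by apply/measurable_EFinP; case: (@unit_valued_bool _ (measurableTypeR R)
    (fun r => r < a)) => //; exact: measurable_fun_ltr.
rewrite subr0 invr1 mul1e.
rewrite (_ : (\int[_]_(x in _) _)%E = a%:E)//.
transitivity (\int[@lebesgue_measure R]_(x in `[0%R, 1%R]) (\1_(`[0, a[%classic : set R) x)%:E)%E.
  apply: eq_integral => x; rewrite inE/= in_itv/= => /andP[x0 x1].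
  by rewrite indicE; congr (_%:R%:E); rewrite mem_setE in_itv/= x0.
rewrite integral_indic//= setIidl; last first.
  move=> x /=; rewrite !in_itv/= => /andP[-> xa]; exact/ltW/(lt_le_trans xa).
rewrite lebesgue_measure_itv/= lte_fin; case: ltP => [|a0']; first by rewrite sube0.
by congr EFin; apply/eqP; rewrite eq_le a0 a0'.
Qed.

(* Integrating over a uniform threshold [r] the inequality between the measures
   of the superlevel sets [u > r]. *)
Lemma le_mean_setwise mu nu (c e : R) u : 0 <= c ->
  (forall B, measurable B -> (mu B <= c%:E * nu B + e%:E)%E) ->
  unit_valued u -> \int[mu]_x u x <= c * \int[nu]_x u x + e.
Proof.
move=> c0 H uu; have [mu0 u01] := uu.
pose f := fun z : T * R => (z.2 < u z.1)%R%:R : R.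
have uf : unit_valued f.
  apply: unit_valued_bool.
  by apply: measurable_fun_ltr => //; exact: measurableT_comp.
pose V := uniform_prob (@ltr01 R).
have E (P : probability T R) :
    \int[P]_x u x = \int[V]_r \int[P]_x f (x, r).
  rewrite -(mean_prod2 P V uf) mean_prod//.
  by apply: eq_Rintegral => x _; exact: (esym (uniform_prob_lt (u01 x))).
have uswap : unit_valued (f \o (fun z : R * T => (z.2, z.1))).
  by apply: unit_valued_comp => //; exact: measurable_fun_pair.
have um (P : probability T R) := unit_valued_bounded (unit_valued_mean P uswap).
rewrite !E -(mean_cst V e) -meanZ; last exact: um.
rewrite -meanD; last 2 first.
- by apply: bounded_measurableZ; exact: um.
- exact: bounded_measurable_cst.
apply: le_mean; first exact: um.
  apply: bounded_measurableD; last exact: bounded_measurable_cst.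
  by apply: bounded_measurableZ; exact: um.
move=> r; have mA : measurable [set x | r < u x].
  have := measurable_fun_ltr (measurable_cst r) mu0 measurableT (I : measurable [set true]).
  by rewrite setTI; congr measurable; apply/seteqP; split.
have fE (P : probability T R) :
    \int[P]_x f (x, r) = fine (P [set x | r < u x]).
  rewrite -mean_indicator//; apply: eq_Rintegral => x _; apply: esym.
  by rewrite /f/= indicE (_ : (x \in _) = (r < u x))//; apply/idP/idP; rewrite inE.
rewrite !fE -lee_fin EFinD EFinM !fineK; [exact: H|exact: fin_num_measure..].
Qed.

End setwise_to_mean.

Section mixture.
Context d d' (Z : measurableType d) (T : measurableType d') (R : realType).
Variables (P : probability Z R) (K : {mfun Z >-> pprobability T R}).

Let kernel (z : Z) : giry T R := (K z : probability T R).

Let measurable_kernel : measurable_fun setT kernel.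
Proof.
apply: measurable_giry_codensity => // B mB.
exact: (kernel.measurable_kernel (kprobability (measurable_funPT K)) B mB).
Qed.

Definition mixture : set T -> \bar R :=
  giry_bind (P : giry Z R) measurable_kernel.

HB.instance Definition _ := Measure.on mixture.

Lemma integral_mixture (h : T -> \bar R) : measurable_fun setT h ->
  (forall t, (0 <= h t)%E) ->
  (\int[mixture]_t h t = \int[P]_z \int[K z : probability T R]_t h t)%E.
Proof. by move=> mh h0; exact: (giry_int_bind P measurable_kernel mh h0). Qed.

Let mixture_setT : mixture setT = 1%E.
Proof.
rewrite -[LHS]mul1e -integral_cst// integral_mixture//.
transitivity (\int[P]_z 1)%E.
  apply: eq_integral => z _; rewrite integral_cst// mul1e.
  exact: (@probability_setT _ _ _ (K z : probability T R)).
rewrite integral_cst// mul1e; exact: (@probability_setT _ _ _ P).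
Qed.

HB.instance Definition _ := Measure_isProbability.Build _ _ _ mixture mixture_setT.

End mixture.

(** * Privacy: replacing the observations one at a time *)

Section mixture_mean.
Context d d' (Z : measurableType d) (T : measurableType d') (R : realType).
Variables (K : {mfun Z >-> pprobability T R}).

Lemma unit_valued_kernel_mean u : unit_valued u ->
  unit_valued (fun z => \int[K z : probability T R]_t u t).
Proof.
move=> uu; split; last by move=> z; exact: mean_unit_valued.
apply/measurable_EFinP.
rewrite (_ : _ \o _ = fun z => (\int[K z : probability T R]_t (u t)%:E)%E).
  apply: measurable_fun_integral_kernel => //.
  - by move=> U mU; exact: (measurable_kernel (kprobability (measurable_funPT K)) U mU).
  - by move=> t; rewrite lee_fin; case: uu => _ /(_ t)/andP[].
  - by apply/measurable_EFinP; case: uu.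
by apply/funext => z /=; rewrite EFin_mean//; exact: unit_valued_bounded.
Qed.

Lemma mean_mixture (P : probability Z R) u : unit_valued u ->
  \int[mixture P K]_t u t = \int[P]_z \int[K z : probability T R]_t u t.
Proof.
move=> uu; apply: EFin_inj; rewrite !EFin_mean//; last 2 first.
- exact: unit_valued_bounded.
- exact/unit_valued_bounded/unit_valued_kernel_mean.
rewrite integral_mixture; last 2 first.
- by apply/measurable_EFinP; case: uu.
- by move=> t; rewrite lee_fin; case: uu => _ /(_ t)/andP[].
by apply: eq_integral => z _; rewrite EFin_mean//; exact: unit_valued_bounded.
Qed.

(** Data processing: the conditional mean of a test is again a test, and by Jensen its square is at
    most the conditional mean of the square. *)
Lemma chi2_dominated_mixture (P Q : probability Z R) (k e : R) : 0 <= k ->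
  chi2_dominated P Q k e -> chi2_dominated (mixture P K) (mixture Q K) k e.
Proof.
move=> k0 H u uu; have uu2 := unit_valued_sqr uu.
rewrite !mean_mixture//; apply: (le_trans (H _ (unit_valued_kernel_mean uu))).
rewrite lerD2r ler_wsqrtr// ler_wpM2l//; apply: le_mean.
- exact/bounded_measurableX/unit_valued_bounded/unit_valued_kernel_mean.
- exact/unit_valued_bounded/unit_valued_kernel_mean.
- by move=> z; apply: sqr_mean_le; exact: unit_valued_bounded.
Qed.

End mixture_mean.

Section tv_domination.
Context d (T : measurableType d) (R : realType).
Implicit Types (mu nu : probability T R) (u : T -> R).

(** Total variation, measured against the oscillation [hi - lo] of the test rather than its
    supremum, because it is the oscillation that privacy controls. *)
Definition tv_dominated mu nu (tau : R) := forall u, unit_valued u ->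
  forall lo hi, (forall x, lo <= u x <= hi) ->
  \int[nu]_x u x <= \int[mu]_x u x + tau * (hi - lo).

(** A test satisfying the privacy inequality stays between [c^-1 a - e] and [c a + e], where [a] is
    its [mu]-mean. Its oscillation is therefore proportional to [a] up to [2 e], which turns the
    total variation bound into a relative one. *)
Lemma tv_dominated_private mu nu (tau c e : R) u : 0 <= tau -> 1 <= c -> 0 <= e ->
  tv_dominated mu nu tau -> unit_valued u ->
  (forall x y, u x <= c * u y + e) ->
  \int[nu]_x u x <=
    (1 + tau * (c - c^-1)) * \int[mu]_x u x + tau * (2 * e).
Proof.
move=> tau0 c1 e0 H uu uc; set a := \int[mu]_x u x.
have bu := unit_valued_bounded uu.
have ci0 : 0 < c^-1 by rewrite invr_gt0 (lt_le_trans ltr01).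
have ci1 : c^-1 <= 1 by rewrite invf_le1// (lt_le_trans ltr01).
have hi x : u x <= c * a + e.
  rewrite -(mean_cst mu (u x)) /a -meanZ// -(mean_cst mu e) -meanD; last 2 first.
  - exact: bounded_measurableZ.
  - exact: bounded_measurable_cst.
  apply: le_mean => //; first exact: bounded_measurable_cst.
  by apply: bounded_measurableD; [exact: bounded_measurableZ|exact: bounded_measurable_cst].
have lo x : c^-1 * a - e <= u x.
  have : a <= c * u x + e.
    rewrite -(mean_cst mu (c * u x + e)); apply: le_mean => //.
    exact: bounded_measurable_cst.
  rewrite -(ler_pM2l ci0) mulrDr mulKf ?gt_eqF ?(lt_le_trans ltr01)//.
  by have := ler_wpM2r e0 ci1; lra.
have := H u uu (c^-1 * a - e) (c * a + e).
rewrite -/a => /(_ _)/le_trans; apply; last by lra.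
by move=> x; rewrite lo hi.
Qed.

End tv_domination.

Section hybrid.
Context (R : realType).
Local Notation sampleR := (sample R).

Lemma neighbours_cons n (x y : sampleR) (z : n.-tuple sampleR) :
  neighbours (cons_pair (x, z)) (cons_pair (y, z)).
Proof.
apply: (@leq_trans #|[set (ord0 : 'I_n.+1)]%SET|); last by rewrite cards1.
apply/subset_leq_card/fintype.subsetP => i; rewrite !inE.
by have [j ->|->//] := unliftP ord0 i; rewrite !tnthS eqxx.
Qed.

Lemma neighbours_cons2 n (x : sampleR) (z z' : n.-tuple sampleR) :
  neighbours z z' -> neighbours (cons_pair (x, z)) (cons_pair (x, z')).
Proof.
rewrite /neighbours => h.
apply: (leq_trans _ h); rewrite -[leqRHS](card_imset _ (@lift_inj _ ord0)).
apply/subset_leq_card/fintype.subsetP => i; rewrite !inE.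
have [j ->|->] := unliftP ord0 i; last by rewrite !tnth0 eqxx.
by rewrite !tnthS => zz; apply/imsetP; exists j => //; rewrite inE.
Qed.

(** Induction on the sample size: at a fixed first observation the others are moved from [Q] to [P],
    then the first one is moved. Averaging over the others preserves the privacy inequality in the
    first coordinate. All additive errors are crudely multiplied by the full power of the factor. *)
Lemma mean_hybrid (P Q : probability sampleR R) (tau c e : R) n
    (F : n.-tuple sampleR -> R) :
  0 <= tau -> 1 <= c -> 0 <= e -> tv_dominated P Q tau -> unit_valued F ->
  (forall z z', neighbours z z' -> F z <= c * F z' + e) ->
  \int[product_law (fun _ : 'I_n => Q)]_z F z <=
  (1 + tau * (c - c^-1)) ^+ n * \int[product_law (fun _ : 'I_n => P)]_z F z +
    (1 + tau * (c - c^-1)) ^+ n * (n%:R * (tau * (2 * e))).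
Proof.
move=> tau0 c1 e0 H uF HF; set a := 1 + tau * (c - c^-1).
have a1 : 1 <= a.
  rewrite /a lerDl mulr_ge0// subr_ge0 (le_trans _ c1)// invf_le1//.
  exact: lt_le_trans c1.
have a0 : 0 <= a by exact: le_trans a1.
elim: n F uF HF => [|n IH] F uF HF.
  by rewrite !mean_product_law0 ?expr0 ?mul1r ?mul0r ?addr0//; case: uF.
have uFc := unit_valued_comp (@measurable_cons_pair _ sampleR n) uF.
rewrite !mean_product_lawS//.
pose g x := \int[product_law (fun _ : 'I_n => P)]_s F (cons_pair (x, s)).
have ug : unit_valued g by exact: (unit_valued_mean _ uFc).
have bg := unit_valued_bounded ug.
have te0 : 0 <= tau * (2 * e) by rewrite !mulr_ge0.
have h1 : \int[Q]_x \int[product_law (fun _ : 'I_n => Q)]_s F (cons_pair (x, s))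
    <= a ^+ n * \int[Q]_x g x + a ^+ n * (n%:R * (tau * (2 * e))).
  set r := _ * (n%:R * _).
  rewrite -(mean_cst Q r) -meanZ// -meanD; last 2 first.
  - exact: bounded_measurableZ.
  - exact: bounded_measurable_cst.
  apply: le_mean; first exact/unit_valued_bounded/(unit_valued_mean _ uFc).
    by apply: bounded_measurableD; [exact: bounded_measurableZ|exact: bounded_measurable_cst].
  move=> x; apply: (IH (fun s => F (cons_pair (x, s)))).
    exact: (unit_valued_section1 x uFc).
  by move=> z z' zz'; apply: HF; exact: neighbours_cons2.
apply: (le_trans h1).
have ub (x : sampleR) := unit_valued_section1 x uFc.
have gg x y : g x <= c * g y + e.
  rewrite /g -(mean_cst (product_law (fun _ : 'I_n => P)) e) -meanZ.
    rewrite -meanD; last 2 first.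
    - exact/bounded_measurableZ/unit_valued_bounded/(ub y).
    - exact: bounded_measurable_cst.
    apply: le_mean.
    - exact/unit_valued_bounded/(ub x).
    - apply: bounded_measurableD; last exact: bounded_measurable_cst.
      exact/bounded_measurableZ/unit_valued_bounded/(ub y).
    - by move=> s; apply: HF; exact: neighbours_cons.
  exact/unit_valued_bounded/(ub y).
have h2 := tv_dominated_private tau0 c1 e0 H ug gg; rewrite -/a in h2.
have an0 : 0 <= a ^+ n by rewrite exprn_ge0.
have anS : a ^+ n <= a ^+ n.+1 by rewrite exprS ler_peMl.
rewrite -(natr1 n) mulrDl mul1r.
have := ler_wpM2l an0 h2.
have : a ^+ n * (n%:R * (tau * (2 * e)) + tau * (2 * e)) <=
    a ^+ n.+1 * (n%:R * (tau * (2 * e)) + tau * (2 * e)).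
  by rewrite ler_wpM2r// addr_ge0// mulr_ge0.
rewrite [a ^+ n.+1]exprS; lra.
Qed.

End hybrid.

(** * Reduction to covariates in [0,1] *)

Section clamp.
Context (R : realType).
Local Notation sampleR := (sample R).

(** Privacy constrains only data sets with covariates in [0,1], whereas the replacement argument
    needs its inequality for all tuples. Composing with this projection provides it everywhere and
    leaves means under the model unchanged. *)
Definition clamp_covariate (z : sampleR) : sampleR :=
  (z.1, Num.min 1 (Num.max 0 (z.2 : R)) : R).

Lemma measurable_clamp_covariate : measurable_fun setT clamp_covariate.
Proof.
apply/measurable_fun_pairP; split; first exact: measurable_fst.
apply: measurable_minr => //; apply: measurable_maxr => //.
Qed.

Definition clamp_covariates n (z : n.-tuple sampleR) : n.-tuple sampleR :=
  [tuple of map clamp_covariate z].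

Lemma measurable_clamp_covariates n : measurable_fun setT (@clamp_covariates n).
Proof.
apply/measurable_fun_tnthP => i.
rewrite (_ : _ \o _ = clamp_covariate \o (fun z => tnth z i)).
  apply: measurableT_comp; first exact: measurable_clamp_covariate.
  exact: measurable_tnth.
by apply/funext => z /=; rewrite tnth_map.
Qed.

Lemma clamp_covariates_in n (z : n.-tuple sampleR) :
  in_sample_space (clamp_covariates z).
Proof.
move=> i; rewrite tnth_map /= le_min ler01 le_max lexx/=.
by rewrite ge_min lexx.
Qed.

Lemma neighbours_clamp n (z z' : n.-tuple sampleR) : neighbours z z' ->
  neighbours (clamp_covariates z) (clamp_covariates z').
Proof.
move=> h; apply: leq_trans h; apply/subset_leq_card/fintype.subsetP => i.
by rewrite !inE !tnth_map; apply: contra => /eqP ->.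
Qed.

Definition clamp_invariant (P : probability sampleR R) := forall u, unit_valued u ->
  \int[P]_z u (clamp_covariate z) = \int[P]_z u z.

Lemma mean_clamp (P : probability sampleR R) n (F : n.-tuple sampleR -> R) :
  clamp_invariant P -> unit_valued F ->
  \int[product_law (fun _ : 'I_n => P)]_z F (clamp_covariates z) =
  \int[product_law (fun _ : 'I_n => P)]_z F z.
Proof.
move=> HP; elim: n F => [|n IH] F uF.
  have mF : measurable_fun setT (F \o @clamp_covariates 0).
    by case: (unit_valued_comp (measurable_clamp_covariates (n := 0)) uF).
  rewrite (mean_product_law0 _ mF) mean_product_law0; last by case: uF.
  by rewrite /= (tuple0 (clamp_covariates _)).
have uFc := unit_valued_comp (@measurable_cons_pair _ sampleR n) uF.
have uFl := unit_valued_comp (measurable_clamp_covariates (n := n.+1)) uF.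
rewrite (mean_product_lawS _ uFl) mean_product_lawS//.
pose g x := \int[product_law (fun _ : 'I_n => P)]_s F (cons_pair (x, s)).
have ug : unit_valued g by exact: (unit_valued_mean _ uFc).
rewrite -[RHS](HP g ug); apply: eq_Rintegral => x _.
rewrite /g -(IH (fun s => F (cons_pair (clamp_covariate x, s)))).
  by apply: eq_Rintegral => s _; congr F; exact: val_inj.
exact: (unit_valued_section1 _ uFc).
Qed.

End clamp.

Section private_server.
Context (R : realType) d (T : measurableType d) (n : nat).
Variables (e de tau : R) (P Q : probability (sample R) R).
Variable K : {mfun n.-tuple (sample R) >-> pprobability T R}.
Hypotheses (e0 : 0 <= e) (de0 : 0 <= de) (tau0 : 0 <= tau).
Hypothesis HK : differentially_private e de K.
Hypotheses (HP : clamp_invariant P) (HQ : clamp_invariant Q).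

Let a := (1 + tau * (expR e - (expR e)^-1)) ^+ n.

Let one_sided P' Q' : clamp_invariant P' -> clamp_invariant Q' ->
    tv_dominated P' Q' tau -> forall u, unit_valued u ->
  \int[mixture (product_law (fun _ : 'I_n => Q')) K]_t u t <=
  a * \int[mixture (product_law (fun _ : 'I_n => P')) K]_t u t +
  a * (n%:R * (tau * (2 * de))).
Proof.
move=> HP' HQ' H u uu; rewrite !mean_mixture//.
have uK := unit_valued_kernel_mean K uu.
rewrite -(mean_clamp HP' uK) -(mean_clamp HQ' uK).
apply: mean_hybrid => //.
- by rewrite -expR0 ler_expR.
- by have := unit_valued_comp (@measurable_clamp_covariates R n) uK.
(* Privacy, a statement on events, becomes an inequality between the means of [u]. *)
move=> z z' zz'; apply: le_mean_setwise => //.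
by move=> B mB; apply: HK => //; [exact: clamp_covariates_in|exact: clamp_covariates_in|exact: neighbours_clamp].
Qed.

(** Both comparisons hold with the factor [a = 1 + (a - 1)], so [chi2_dominated_close] applies with
    [s = a - 1]. *)
Lemma chi2_dominated_private : tv_dominated P Q tau -> tv_dominated Q P tau ->
  chi2_dominated (mixture (product_law (fun _ : 'I_n => P)) K)
    (mixture (product_law (fun _ : 'I_n => Q)) K)
    (1 + (a - 1) ^+ 2) (2 * (a * (n%:R * (tau * (2 * de))))).
Proof.
move=> H1 H2; apply: chi2_dominated_close.
- rewrite subr_ge0 exprn_ege1// lerDl mulr_ge0// subr_ge0.
  have e1 : 1 <= expR e by rewrite -expR0 ler_expR.
  by rewrite (le_trans _ e1)// invf_le1// (lt_le_trans _ e1).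
- by move=> u uu; rewrite [1 + _]addrC subrK; exact: one_sided.
- by move=> u uu; rewrite [1 + _]addrC subrK; exact: one_sided.
Qed.

End private_server.

(** * Gaussian observations *)

Section integral_density.
Context d (T : measurableType d) (R : realType).
Variables (mu nu : {measure set T -> \bar R}) (g : T -> R).
Hypotheses (mg : measurable_fun setT g) (g0 : forall x, 0 <= g x).
Hypothesis nuE : forall A, measurable A -> nu A = (\int[mu]_(x in A) (g x)%:E)%E.

Import HBNNSimple.

Let integral_density_nnsfun (f : {nnsfun T >-> R}) :
  (\int[nu]_x (f x)%:E = \int[mu]_x (f x * g x)%:E)%E.
Proof.
have fgE x : ((f x * g x)%:E = \sum_(r \in range f)
    (r%:E * ((\1_(f @^-1` [set r]) x)%:E * (g x)%:E)))%E.
  rewrite {1}fimfunE EFinM -fsumEFin// ge0_mule_fsuml; last first.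
    by move=> r; rewrite EFinM nnfun_muleindic_ge0.
  by apply: eq_fsbigr => r _; rewrite EFinM muleA.
under [RHS]eq_integral do rewrite fgE.
have mig r : measurable_fun setT
    (fun x => (\1_(f @^-1` [set r]) x)%:E * (g x)%:E)%E.
  by apply: emeasurable_funM; exact/measurable_EFinP.
rewrite ge0_integral_fsum//=; last 2 first.
- by move=> r; exact: measurable_funeM.
- move=> r x _; rewrite muleA; apply: mule_ge0; last by rewrite lee_fin.
  exact: nnfun_muleindic_ge0.
rewrite integralT_nnsfun sintegralE; apply: eq_fsbigr => r /[!inE] -[y _ yr].
have r0 : 0 <= r by rewrite -yr.
rewrite ge0_integralZl//; last by move=> x _; rewrite mule_ge0 ?lee_fin.
rewrite nuE//; congr *%E; rewrite [LHS]integral_mkcond; apply: eq_integral => x _.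
by rewrite patchE indicE; case: ifPn; rewrite ?mul1e ?mul0e.
Qed.

(** Monotone convergence from simple functions. It serves to pass from [normal_prob] to Lebesgue
    measure, where the shift is a change of variable. *)
Lemma integral_density (h : T -> \bar R) : measurable_fun setT h ->
  (forall x, (0 <= h x)%E) ->
  (\int[nu]_x h x = \int[mu]_x (h x * (g x)%:E))%E.
Proof.
move=> mh h0; pose h_ := nnsfun_approx measurableT mh.
transitivity (limn (fun n => \int[nu]_x (h_ n x)%:E))%E.
  rewrite -monotone_convergence//=.
  - by apply: eq_integral => x _; apply/esym/cvg_lim => //; exact: cvg_nnsfun_approx.
  - by move=> n; exact/measurable_EFinP/measurable_funTS.
  - by move=> n x _; rewrite lee_fin.
  - by move=> x _ m n mn; rewrite lee_fin; exact/lefP/nd_nnsfun_approx.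
transitivity (limn (fun n => \int[mu]_x ((h_ n x)%:E * (g x)%:E)))%E.
  by apply: congr_lim; apply/funext => n; rewrite integral_density_nnsfun.
rewrite -monotone_convergence//=.
- apply: eq_integral => x _; apply/cvg_lim => //.
  by apply: cvgeMr => //; exact: cvg_nnsfun_approx.
- by move=> n; apply: emeasurable_funM; exact/measurable_EFinP.
- by move=> n x _; rewrite mule_ge0 ?lee_fin.
- move=> x _ m n mn; apply: lee_wpmul2r; rewrite lee_fin//.
  exact/lefP/nd_nnsfun_approx.
Qed.

End integral_density.

Section lebesgue_affine.
Context (R : realType) (s c : R).
Hypothesis s0 : 0 < s.
Local Notation leb := (@lebesgue_measure R).

Let affine (x : measurableTypeR R) : measurableTypeR R := s * x + c.

Let measurable_affine : measurable_fun setT affine.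
Proof. by apply: measurable_funD => //; exact: measurable_funM. Qed.

Let affine_mfun : {mfun measurableTypeR R >-> measurableTypeR R} :=
  HB.pack affine (isMeasurableFun.Build _ _ _ _ affine measurable_affine).

Let image : set (measurableTypeR R) -> \bar R := pushforward leb affine_mfun.

Let image0 : image set0 = 0%E.
Proof. exact: measure0. Qed.

Let image_ge0 A : (0 <= image A)%E.
Proof. exact: measure_ge0. Qed.

Let image_sigma_additive : semi_sigma_additive image.
Proof. exact: measure_semi_sigma_additive. Qed.

HB.instance Definition _ := isMeasure.Build _ _ _ image
  image0 image_ge0 image_sigma_additive.

Let scaled := mscale (NngNum (ltW s0)) image.

(** The image of Lebesgue measure under the affine map, multiplied by [s], gives half-open intervals
    their length; uniqueness does the rest. *)
Let scaledE A : measurable A -> leb A = scaled A.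
Proof.
apply: lebesgue_measure_unique => _ [[a b] /= _ <-].
rewrite /scaled /mscale/= /image /pushforward.
rewrite (_ : affine_mfun @^-1` _ = `](s^-1 * (a - c)), (s^-1 * (b - c))]%classic).
  rewrite !lebesgue_measure_itv/= !lte_fin ltr_pM2l ?invr_gt0// ltrD2r.
  case: ltP => ab; last by rewrite mule0.
  rewrite -!EFinD -EFinM; congr EFin; field; exact: lt0r_neq0.
apply/seteqP; split => x /=; rewrite !in_itv/= /affine;
  rewrite ltr_pdivrMl// ler_pdivlMl// ltrBlDr lerBrDr//.
Qed.

Lemma ge0_integral_affine (h : R -> \bar R) :
  measurable_fun (setT : set (measurableTypeR R)) h -> (forall x, (0 <= h x)%E) ->
  (\int[leb]_x h x = s%:E * \int[leb]_x h (s * x + c)%R)%E.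
Proof.
move=> mh h0; rewrite (eq_measure_integral scaled); last by move=> A mA _; exact: scaledE.
rewrite ge0_integral_mscale//=; congr *%E.
by rewrite ge0_integral_pushforward.
Qed.

End lebesgue_affine.

Section cauchy_schwarz.
Context d (T : measurableType d) (R : realType) (mu : {measure set T -> \bar R}).
Variables (D : set T) (f g : T -> R).
Hypotheses (mD : measurable D) (mf : measurable_fun D f) (mg : measurable_fun D g).
Hypotheses (f2 : mu.-integrable D (fun x => (f x ^+ 2)%:E))
  (g2 : mu.-integrable D (fun x => (g x ^+ 2)%:E)).

Lemma integrable_mul_sqr : mu.-integrable D (fun x => (f x * g x)%:E).
Proof.
apply: (le_integrable _ _ _ (integrableD mD f2 g2)) => //.
  by apply/measurable_EFinP; exact: measurable_funM.
move=> x _ /=; rewrite lee_fin normrM.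
rewrite [leRHS]ger0_norm ?addr_ge0 ?sqr_ge0// -(real_normK (num_real (f x))).
rewrite -(real_normK (num_real (g x))); have := sqr_ge0 (`|f x| - `|g x|).
have := mulr_ge0 (normr_ge0 (f x)) (normr_ge0 (g x)); nra.
Qed.

(** The integral of [(f - l g)^2] is nonnegative for every real [l]; take [l = B / C]. *)
Lemma cauchy_schwarz : (\int[mu]_(x in D) (f x * g x)) ^+ 2 <=
  \int[mu]_(x in D) (f x ^+ 2) * \int[mu]_(x in D) (g x ^+ 2).
Proof.
set A := \int[mu]_(x in D) (f x ^+ 2); set C := \int[mu]_(x in D) (g x ^+ 2).
set B := \int[mu]_(x in D) _.
have H (l : R) : 0 <= A - 2 * l * B + l ^+ 2 * C.
  have ifg := integrable_mul_sqr.
  rewrite (_ : _ + _ = \int[mu]_(x in D) ((f x ^+ 2 - 2 * l * (f x * g x)) +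
      l ^+ 2 * (g x ^+ 2))).
    apply: Rintegral_ge0 => x _; have := sqr_ge0 (f x - l * g x); lra.
  have i1 : mu.-integrable D (EFin \o (fun x => 2 * l * (f x * g x))).
    exact: (integrableZl mD (2 * l) ifg).
  have i2 : mu.-integrable D (EFin \o (fun x => l ^+ 2 * (g x ^+ 2))).
    exact: (integrableZl mD (l ^+ 2) g2).
  rewrite RintegralD//; last exact: (integrableB mD f2 i1).
  by rewrite RintegralB// !RintegralZl.
have [C0|C0] := eqVneq C 0.
  have [->|B0] := eqVneq B 0; first by rewrite C0 mulr0 expr0n.
  (* For [C = 0] the quadratic is affine in [l], and this [l] would give it the value -1. *)
  have := H ((A + 1) / (2 * B)); rewrite C0 mulr0 addr0.
  rewrite (_ : 2 * _ * B = A + 1); first by lra.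
  by field.
have C0' : 0 < C.
  by rewrite lt_neqAle eq_sym C0 Rintegral_ge0// => x _; rewrite sqr_ge0.
have := mulr_ge0 (H (B / C)) (ltW C0').
rewrite (_ : (A - 2 * (B / C) * B + (B / C) ^+ 2 * C) * C = A * C - B ^+ 2); first by lra.
by field.
Qed.

End cauchy_schwarz.

Section gaussian_shift.
Context (R : realType) (b : R).
Local Notation N := (@normal_prob R 0 1).

(** The density of [N(b,1)] with respect to [N(0,1)]. *)
Definition gaussian_ratio (y : R) := expR (b * y - b ^+ 2 / 2).

Lemma measurable_gaussian_ratio : measurable_fun setT gaussian_ratio.
Proof.
apply: measurableT_comp => //; apply: measurable_funB => //.
Qed.

Lemma ge0_integral_gaussian_shift (h : R -> R) :
  measurable_fun (setT : set (measurableTypeR R)) h -> (forall x, 0 <= h x) ->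
  (\int[N]_y (h (b + y))%:E = \int[N]_y (h y * gaussian_ratio y)%:E)%E.
Proof.
move=> mh h0.
have mpdf : measurable_fun setT (@normal_pdf R 0 1) by exact: measurable_normal_pdf.
have pdf0 x : 0 <= @normal_pdf R 0 1 x by exact: normal_pdf_ge0.
have mhb : measurable_fun (setT : set (measurableTypeR R)) (fun y => h (b + y)).
  by apply: (measurableT_comp mh); exact: measurable_funD.
rewrite (@integral_density _ _ R (@lebesgue_measure R) N _ mpdf pdf0 (fun _ _ => erefl))//=; last 2 first.
- exact/measurable_EFinP.
- by move=> x; rewrite lee_fin.
rewrite (@integral_density _ _ R (@lebesgue_measure R) N _ mpdf pdf0 (fun _ _ => erefl))//=; last 2 first.
- by apply/measurable_EFinP; apply: measurable_funM => //; exact: measurable_gaussian_ratio.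
- by move=> x; rewrite lee_fin mulr_ge0// expR_ge0.
apply: (etrans (@ge0_integral_affine R 1 (- b) ltr01
  (fun x => ((h (b + x))%:E * (normal_pdf 0 1 x)%:E)%E) _ _)).
- by apply: emeasurable_funM; exact/measurable_EFinP.
- by move=> x; rewrite mule_ge0 ?lee_fin.
rewrite mul1e.
apply: eq_integral => x _; rewrite -!EFinM; congr EFin.
rewrite mul1r addrC subrK -mulrA; congr (_ * _).
rewrite /normal_pdf oner_eq0 mulrCA; congr (_ * _).
rewrite /normal_fun /gaussian_ratio -expRD; congr expR.
by rewrite expr1n; field.
Qed.

End gaussian_shift.

Section gaussian_bounds.
Context (R : realType) (b : R).
Local Notation N := (@normal_prob R 0 1).

Lemma expR_le1D2x (t : R) : 0 <= t <= 2^-1 -> expR t <= 1 + 2 * t.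
Proof.
move=> /andP[t0 t1]; have h : 1 - t <= expR (- t) by exact: expR_ge1Dx.
have e0 := expR_gt0 t; have : expR t * expR (- t) = 1 by rewrite -expRD subrr expR0.
have := ler_wpM2l (ltW e0) h.
nra.
Qed.

Lemma gaussian_ratio_mean c : (\int[N]_y (gaussian_ratio c y)%:E = 1 :> \bar R)%E.
Proof.
transitivity (\int[N]_y (1 * gaussian_ratio c y)%:E)%E.
  by apply: eq_integral => y _; rewrite mul1r.
rewrite -(@ge0_integral_gaussian_shift R c (fun=> 1))// integral_cst//.
by rewrite mul1e; exact: (@probability_setT _ _ _ N).
Qed.

(** Up to a constant the square is the ratio for the shift [2 b], so the second moment follows from
    the total mass 1. *)
Lemma gaussian_ratio_sqr y :
  gaussian_ratio b y ^+ 2 = expR (b ^+ 2) * gaussian_ratio (2 * b) y.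
Proof. by rewrite /gaussian_ratio -expRM_natl -expRD; congr expR; field. Qed.

Lemma integrable_gaussian_ratio c :
  N.-integrable setT (fun y => (gaussian_ratio c y)%:E).
Proof.
apply/integrableP; split.
  by apply/measurable_EFinP; exact: measurable_gaussian_ratio.
apply/abse_integralP => //=; last by rewrite gaussian_ratio_mean abse1 ltry.
by apply/measurable_EFinP; exact: measurable_gaussian_ratio.
Qed.

Lemma integrable_gaussian_ratio_sqr :
  N.-integrable setT (fun y => (gaussian_ratio b y ^+ 2)%:E).
Proof.
rewrite (_ : (fun _ => _) = fun y => ((expR (b ^+ 2))%:E * (gaussian_ratio (2 * b) y)%:E)%E).
  by apply: integrableZl => //; exact: integrable_gaussian_ratio.
by apply/funext => y; rewrite gaussian_ratio_sqr EFinM.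
Qed.

Lemma Rintegral_gaussian_ratio : \int[N]_y gaussian_ratio b y = 1.
Proof. by rewrite /Rintegral gaussian_ratio_mean. Qed.

Lemma Rintegral_gaussian_ratio_sqr :
  \int[N]_y (gaussian_ratio b y ^+ 2) = expR (b ^+ 2).
Proof.
under eq_Rintegral do rewrite gaussian_ratio_sqr.
rewrite RintegralZl//; last exact: integrable_gaussian_ratio.
by rewrite /Rintegral gaussian_ratio_mean mulr1.
Qed.

Variable v : measurableTypeR R -> R.
Hypothesis uv : unit_valued v.
Let bv := unit_valued_bounded uv.

Let mv : measurable_fun setT v. Proof. by case: uv. Qed.

Let v2_integrable : N.-integrable setT (fun y => (v y ^+ 2)%:E).
Proof. by apply: bounded_measurable_integrable; exact: bounded_measurableX. Qed.

Lemma mean_gaussian_shift : \int[N]_y v (b + y) = \int[N]_y (v y * gaussian_ratio b y).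
Proof.
by congr fine; apply: ge0_integral_gaussian_shift => // x; case: uv => _ /(_ x)/andP[].
Qed.

Lemma sqr_mean_gaussian_shift :
  (\int[N]_y v (b + y)) ^+ 2 <= expR (b ^+ 2) * \int[N]_y (v y ^+ 2).
Proof.
rewrite mean_gaussian_shift mulrC -Rintegral_gaussian_ratio_sqr.
apply: cauchy_schwarz => //; first exact: measurable_gaussian_ratio.
exact: integrable_gaussian_ratio_sqr.
Qed.

(** The difference is the integral of [v - lo] against [gaussian_ratio b - 1]; subtracting [lo] is
    free because the latter has mean 0. Cauchy-Schwarz then involves its second moment
    [expR (b ^+ 2) - 1], of order [b ^+ 2] for small [b]. *)
Lemma mean_gaussian_shift_tv (lo hi : R) : b ^+ 2 <= 2^-1 ->
  (forall y, lo <= v y <= hi) ->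
  `|\int[N]_y v (b + y) - \int[N]_y v y| <= (hi - lo) * (2 * `|b|).
Proof.
move=> b2 vlh; have lohi : lo <= hi.
  by have /andP[h1 h2] := vlh 0; exact: le_trans h2.
pose w y := v y - lo; pose g y := gaussian_ratio b y - 1.
have mw : measurable_fun setT w by exact: measurable_funB.
have bw : bounded_measurable w.
  by apply: bounded_measurableB => //; exact: bounded_measurable_cst.
have mg : measurable_fun setT g.
  by apply: measurable_funB => //; exact: measurable_gaussian_ratio.
have i1 := integrable_gaussian_ratio b.
have i2 := integrable_gaussian_ratio_sqr.
have ic (c : R) : N.-integrable setT (EFin \o (fun=> c)).
  exact/bounded_measurable_integrable/bounded_measurable_cst.
have i3 : N.-integrable setT (EFin \o (fun y => gaussian_ratio b y ^+ 2 - 2 * gaussian_ratio b y)).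
  exact: (integrableB measurableT i2 (integrableZl measurableT 2 i1)).
have g2E : (fun y => g y ^+ 2) =
    (fun y => gaussian_ratio b y ^+ 2 - 2 * gaussian_ratio b y + 1).
  by apply/funext => y; rewrite /g; ring.
have ig2 : N.-integrable setT (EFin \o (fun y => g y ^+ 2)).
  rewrite g2E; exact: (integrableD measurableT i3 (ic 1)).
have iw2 : N.-integrable setT (fun y => (w y ^+ 2)%:E).
  by apply: bounded_measurable_integrable; exact: bounded_measurableX.
have Eg2 : \int[N]_y (g y ^+ 2) = expR (b ^+ 2) - 1.
  rewrite g2E RintegralD// RintegralB//; last exact: (integrableZl measurableT _ i1).
  rewrite RintegralZl// Rintegral_gaussian_ratio Rintegral_gaussian_ratio_sqr.
  by rewrite (mean_cst N 1); ring.
have Ew2 : \int[N]_y (w y ^+ 2) <= (hi - lo) ^+ 2.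
  rewrite -[leRHS](mean_cst N); apply: le_mean.
  - exact: bounded_measurableX.
  - exact: bounded_measurable_cst.
  - by move=> y; have /andP[h1 h2] := vlh y; rewrite lerXn2r ?nnegrE /w; lra.
have ivg : N.-integrable setT (EFin \o (fun y => v y * gaussian_ratio b y)).
  by apply: integrable_mul_sqr => //; exact: measurable_gaussian_ratio.
have E : \int[N]_y v (b + y) - \int[N]_y v y = \int[N]_y (w y * g y).
  rewrite mean_gaussian_shift.
  have -> : (fun y => w y * g y) = (fun y => (v y * gaussian_ratio b y - v y) -
      (lo * gaussian_ratio b y - lo)).
    by apply/funext => y; rewrite /w /g; ring.
  have iv : N.-integrable setT (EFin \o v) by exact: bounded_measurable_integrable.
  have il : N.-integrable setT (EFin \o (fun y => lo * gaussian_ratio b y)).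
    exact: (integrableZl measurableT _ i1).
  rewrite RintegralB//; last 2 first.
  - exact: (integrableB measurableT ivg iv).
  - exact: (integrableB measurableT il (ic lo)).
  rewrite RintegralB// RintegralB// RintegralZl// Rintegral_gaussian_ratio.
  by rewrite (mean_cst N lo); ring.
have CS := cauchy_schwarz measurableT mw mg iw2 ig2.
rewrite -E Eg2 in CS.
rewrite -ler_sqr ?nnegrE ?mulr_ge0 ?subr_ge0// real_normK ?num_real//.
apply: (le_trans CS); rewrite !exprMn real_normK ?num_real//.
have b20 := sqr_ge0 b.
have e1' : expR (b ^+ 2) - 1 <= 2 ^+ 2 * b ^+ 2.
  by have := expR_le1D2x (_ : 0 <= b ^+ 2 <= 2^-1); rewrite b20 b2 => /(_ isT); lra.
apply: ler_pM => //.
- by apply: Rintegral_ge0 => y _; exact: sqr_ge0.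
- by rewrite -Eg2; apply: Rintegral_ge0 => y _; exact: sqr_ge0.
Qed.

End gaussian_bounds.

Section single_observation.
Context (R : realType).
Local Notation N := (@normal_prob R 0 1).
Local Notation U := (uniform_prob (@ltr01 R)).
Implicit Types (f : {mfun R >-> R}) (u : sample R -> R).

Lemma unit_valued_noise f u : unit_valued u ->
  unit_valued (fun x => \int[N]_y u (f x + y, x)).
Proof.
move=> uu; have := unit_valued_comp (measurable_observe f) uu.
by move=> /(unit_valued_mean N).
Qed.

Lemma mean_obs_law f u : unit_valued u ->
  \int[obs_law f]_z u z = \int[U]_x \int[N]_y u (f x + y, x).
Proof.
move=> uu; rewrite mean_distribution//.
by have := mean_prod U N (unit_valued_comp (measurable_observe f) uu).
Qed.

Lemma mean_uniform_eq (g h : measurableTypeR R -> R) :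
  unit_valued g -> unit_valued h -> (forall x, 0 <= x <= 1 -> g x = h x) ->
  \int[U]_x g x = \int[U]_x h x.
Proof.
move=> [mg g01] [mh h01] gh; rewrite /Rintegral !integral_uniform//; last 4 first.
- exact/measurable_EFinP.
- by move=> x; rewrite lee_fin; have /andP[] := h01 x.
- exact/measurable_EFinP.
- by move=> x; rewrite lee_fin; have /andP[] := g01 x.
congr (fine (_ * _)); apply: eq_integral => x.
by rewrite inE/= in_itv/= => /gh ->.
Qed.

Lemma uniform_prob_itv (c b : R) : 0 <= b -> fine (U `[c, c + b]%classic) <= b.
Proof.
move=> b0; rewrite -mean_indicator//.
have m1 : measurable_fun setT (\1_(`[c, c + b]%classic : set (measurableTypeR R)) : _ -> R).
  exact: measurable_indic.
rewrite /Rintegral integral_uniform//; last exact/measurable_EFinP.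
rewrite subr0 invr1 mul1e integral_indic//= -lee_fin fineK.
  apply: (@le_trans _ _ (lebesgue_measure (`[c, c + b]%classic : set R))).
    by apply: le_measure => //; rewrite ?inE//; exact: measurableI.
  rewrite lebesgue_measure_itv/= lte_fin; case: ifPn => _; last by rewrite lee_fin.
  by rewrite -EFinB lee_fin; lra.
rewrite ge0_fin_numE//.
apply: (@le_lt_trans _ _ (lebesgue_measure (`[0, 1]%classic : set R))).
  by apply: le_measure => //; rewrite ?inE//; exact: measurableI.
by rewrite lebesgue_measure_itv/= lte_fin ltr01 sube0 ltry.
Qed.

Lemma mean_uniform_bump (g : measurableTypeR R -> R) (a c b : R) :
  measurable_fun setT g -> 0 <= a -> 0 <= b ->
  (forall x, 0 <= g x <= a) -> (forall x, g x != 0 -> c <= x <= c + b) ->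
  \int[U]_x g x <= a * b.
Proof.
move=> mg a0 b0 ga gc.
apply: (@le_trans _ _ (\int[U]_x (a * \1_(`[c, c + b]%classic) x))).
  apply: le_mean.
  - split => //; exists a => x; by have /andP[h1 h2] := ga x; rewrite ger0_norm.
  - apply: bounded_measurableZ; split; first exact: measurable_indic.
    by exists 1 => x; rewrite indicE; case: (_ \in _); rewrite ?normr1 ?normr0.
  - move=> x; have /andP[h1 h2] := ga x.
    have [->|gx] := eqVneq (g x) 0; first by rewrite mulr_ge0// indicE.
    by rewrite indicE mem_set ?mulr1//= in_itv/= gc.
rewrite meanZ; last first.
  split; first exact: measurable_indic.
  by exists 1 => x; rewrite indicE; case: (_ \in _); rewrite ?normr1 ?normr0.
by rewrite ler_wpM2l// mean_indicator// uniform_prob_itv.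
Qed.

Lemma clamp_invariant_obs_law f : clamp_invariant (obs_law f).
Proof.
move=> u uu; have uuc := unit_valued_comp (@measurable_clamp_covariate R) uu.
rewrite (mean_obs_law f uuc) (mean_obs_law f uu).
apply: (mean_uniform_eq (unit_valued_noise f uuc) (unit_valued_noise f uu)).
move=> x /andP[x0 x1]; apply: eq_Rintegral => y _ /=.
by rewrite /clamp_covariate/= (max_r x0) (min_r x1).
Qed.

Section two_points.
Variables f g : {mfun R >-> R}.
Hypothesis f0 : forall x, f x = 0.
Variables (a c b : R).
Hypotheses (a0 : 0 <= a) (b0 : 0 <= b) (a1 : a ^+ 2 <= 2^-1).
Hypotheses (ga : forall x, `|g x| <= a) (gc : forall x, g x != 0 -> c <= x <= c + b).

Let g2 x : g x ^+ 2 <= a ^+ 2.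
Proof. by rewrite -real_normK ?num_real// lerXn2r ?nnegrE. Qed.

Let mg : measurable_fun setT (g : measurableTypeR R -> R).
Proof. exact: (measurable_funPT g). Qed.

(** Cauchy-Schwarz is used twice: in the noise at a fixed covariate, with loss
    [expR (g x ^+ 2 / 2)], and then in the covariate. The mean of [expR (g x ^+ 2)] is at most
    [1 + 2 a^2 b], as [g ^+ 2 <= a ^+ 2] vanishes outside an interval of length [b]. *)
Lemma chi2_dominated_obs_law :
  chi2_dominated (obs_law f) (obs_law g) (1 + 2 * (a ^+ 2 * b)) 0.
Proof.
move=> u uu; have uu2 := unit_valued_sqr uu.
rewrite !mean_obs_law// addr0.
pose V x := \int[N]_y (u (y, x) ^+ 2).
have VE : (fun x => \int[N]_y (u (f x + y, x) ^+ 2)) = V.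
  by apply/funext => x; apply: eq_Rintegral => y _; rewrite f0 add0r.
have uV : unit_valued V by rewrite -VE; exact: (unit_valued_noise f uu2).
rewrite VE.
pose s (x : measurableTypeR R) : R := expR (g x ^+ 2 / 2).
pose q (x : measurableTypeR R) : R := Num.sqrt (V x).
have bs : bounded_measurable s.
  split; first by apply: measurableT_comp => //; apply: measurable_funM => //; exact: measurable_funX.
  exists (expR (a ^+ 2 / 2)) => x; rewrite ger0_norm ?expR_ge0// ler_expR.
  by rewrite ler_wpM2r.
have bq : bounded_measurable q.
  split; first by apply: measurableT_comp; [exact: continuous_measurable_fun (@sqrt_continuous R)|case: uV].
  exists 1 => x; rewrite ger0_norm ?sqrtr_ge0// -[leRHS]sqrtr1 ler_wsqrtr//.
  by case: uV => _ /(_ x)/andP[].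
have V0 x : 0 <= V x by case: uV => _ /(_ x)/andP[].
have h1 : \int[U]_x \int[N]_y u (g x + y, x) <= \int[U]_x (s x * q x).
  apply: le_mean; first exact/unit_valued_bounded/unit_valued_noise.
    exact: bounded_measurableM.
  move=> x; have uux := unit_valued_section2 x uu.
  have := sqr_mean_gaussian_shift (g x) uux; rewrite -/(V x) => h.
  have /andP[m0 _] := mean_unit_valued N
    (unit_valued_section1 x (unit_valued_comp (measurable_observe g) uu)).
  rewrite -ler_sqr ?nnegrE ?mulr_ge0 ?expR_ge0 ?sqrtr_ge0//.
  rewrite exprMn sqr_sqrtr// /s -expRM_natl.
  by rewrite (_ : 2%:R * (g x ^+ 2 / 2) = g x ^+ 2)//; field.
apply: (le_trans h1).
have sq0 : 0 <= \int[U]_x (s x * q x).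
  by apply: Rintegral_ge0 => x _; rewrite mulr_ge0 ?expR_ge0 ?sqrtr_ge0.
rewrite -[leLHS](ger0_norm sq0) -sqrtr_sqr ler_wsqrtr//.
have [ms _] := bs; have [mq _] := bq.
have is2 := bounded_measurable_integrable U (bounded_measurableX 2 bs).
have iq2 := bounded_measurable_integrable U (bounded_measurableX 2 bq).
apply: (le_trans (cauchy_schwarz measurableT ms mq is2 iq2)).
have Eq : \int[U]_x (q x ^+ 2) = \int[U]_x V x.
  by apply: eq_Rintegral => x _; rewrite sqr_sqrtr.
rewrite Eq ler_wpM2r//; first by apply: Rintegral_ge0.
apply: (@le_trans _ _ (\int[U]_x (1 + 2 * (g x ^+ 2)))).
  apply: le_mean; first exact: bounded_measurableX.
    apply: bounded_measurableD; first exact: bounded_measurable_cst.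
    apply: bounded_measurableZ; apply: bounded_measurableX; split => //.
    by exists a.
  move=> x; rewrite /s -expRM_natl (_ : 2%:R * (g x ^+ 2 / 2) = g x ^+ 2); last by field.
  by apply: expR_le1D2x; rewrite sqr_ge0 (le_trans (g2 x)).
have bg2 : bounded_measurable (fun x => g x ^+ 2).
  by apply: bounded_measurableX; split => //; exists a.
rewrite meanD ?mean_cst ?meanZ//; last 2 first.
- exact: bounded_measurable_cst.
- exact: bounded_measurableZ.
rewrite lerD2l ler_wpM2l//; apply: (mean_uniform_bump (c := c)) => //.
- exact: measurable_funX.
- exact: sqr_ge0.
- by move=> x; rewrite sqr_ge0 g2.
- by move=> x; rewrite sqrf_eq0 => /gc.
Qed.

(** At a fixed covariate the Gaussian shift costs [2 |g x|], and [|g|] has mean at most [a * b]. *)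
Let tv_aux u lo hi : unit_valued u -> (forall x, lo <= u x <= hi) ->
  `|\int[obs_law g]_z u z - \int[obs_law f]_z u z| <= 2 * (a * b) * (hi - lo).
Proof.
move=> uu ulh; rewrite !mean_obs_law//.
have lohi : 0 <= hi - lo.
  by rewrite subr_ge0; have /andP[h1 h2] := ulh (0, 0); exact: le_trans h2.
have bN h := unit_valued_bounded (unit_valued_noise h uu).
have bgn : bounded_measurable (fun x => `|g x|).
  by apply: bounded_measurable_norm; split => //; exists a.
rewrite -meanB//; [|exact: (bN g)|exact: (bN f)].
have bB := bounded_measurableB (bN g) (bN f).
apply: (le_trans (le_normr_Rintegral measurableT (bounded_measurable_integrable U bB))).
apply: (@le_trans _ _ (\int[U]_x ((hi - lo) * 2 * `|g x|))).
  apply: le_mean; first exact: bounded_measurable_norm.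
    exact: bounded_measurableZ.
  move=> x; rewrite -mulrA.
  rewrite (_ : \int[N]_y u (f x + y, x) = \int[N]_y u (y, x)); last first.
    by apply: eq_Rintegral => y _; rewrite f0 add0r.
  apply: (mean_gaussian_shift_tv (unit_valued_section2 x uu)) => //.
  exact: le_trans (g2 x) a1.
rewrite meanZ// [leRHS]mulrC -mulrA ler_wpM2l// ler_wpM2l//.
apply: (mean_uniform_bump (c := c)) => //.
- by case: bgn.
- by move=> x; rewrite normr_ge0 ga.
- by move=> x; rewrite normr_eq0 => /gc.
Qed.

Lemma tv_dominated_obs_law : tv_dominated (obs_law f) (obs_law g) (2 * (a * b)).
Proof.
move=> u uu lo hi /(tv_aux uu); rewrite ler_norml => /andP[_].
by rewrite lerBlDl.
Qed.

Lemma tv_dominated_obs_law_sym : tv_dominated (obs_law g) (obs_law f) (2 * (a * b)).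
Proof.
move=> u uu lo hi /(tv_aux uu); rewrite distrC ler_norml => /andP[_].
by rewrite lerBlDl.
Qed.

End two_points.
End single_observation.

(** * Independence of the transcripts *)

Section integral_product_law.
Local Open Scope ereal_scope.
Context d (T : measurableType d) (R : realType).

Lemma integral_product_law0 (P : 'I_0 -> probability T R) (f : 0.-tuple T -> \bar R) :
  measurable_fun setT f -> \int[product_law P]_t f t = f [tuple].
Proof. by move=> mf; rewrite /= integral_dirac//= diracT mul1e. Qed.

Lemma integral_product_lawS n (P : 'I_n.+1 -> probability T R)
    (f : n.+1.-tuple T -> \bar R) : measurable_fun setT f -> (forall t, 0 <= f t) ->
  \int[product_law P]_t f t =
  \int[P ord0]_x \int[product_law (fun i => P (lift ord0 i))]_s f (cons_pair (x, s)).
Proof.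
move=> mf f0; rewrite /= ge0_integral_distribution//.
rewrite fubini_tonelli1//=.
exact: (measurableT_comp mf (@measurable_cons_pair _ T n)).
Qed.

Lemma measurable_cat_tuple a b :
  measurable_fun setT (fun z : a.-tuple T * b.-tuple T => [tuple of z.1 ++ z.2]).
Proof.
apply/measurable_fun_tnthP => i; case: (split_ordP i) => j ->.
  rewrite (_ : _ \o _ = (fun x => tnth x j) \o fst); last first.
    by apply/funext => z /=; rewrite tnth_lshift.
  by apply: measurableT_comp; [exact: measurable_tnth|exact: measurable_fst].
rewrite (_ : _ \o _ = (fun x => tnth x j) \o snd); last first.
  by apply/funext => z /=; rewrite tnth_rshift.
by apply: measurableT_comp; [exact: measurable_tnth|exact: measurable_snd].
Qed.

Lemma integral_product_law_cat (P : probability T R) a b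
    (f : (a + b).-tuple T -> \bar R) : measurable_fun setT f -> (forall t, 0 <= f t) ->
  \int[product_law (fun _ : 'I_(a + b) => P)]_t f t =
  \int[product_law (fun _ : 'I_a => P)]_x
    \int[product_law (fun _ : 'I_b => P)]_y f [tuple of x ++ y].
Proof.
elim: a f => [|a IH] f mf f0.
  have mcat := @measurable_fun_fubini_tonelli_F _ _ _ _ R
    (product_law (fun _ : 'I_b => P))
    (fun z : 0.-tuple T * b.-tuple T => f [tuple of z.1 ++ z.2]).
  rewrite integral_product_law0.
    by apply: eq_integral => y _; congr f; exact: val_inj.
  apply: mcat => //.
  exact: (measurableT_comp mf (@measurable_cat_tuple 0 b)).
have mcat := @measurable_fun_fubini_tonelli_F _ _ _ _ R
    (product_law (fun _ : 'I_b => P))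
    (fun z : a.+1.-tuple T * b.-tuple T => f [tuple of z.1 ++ z.2]).
rewrite (@integral_product_lawS (a + b) (fun=> P) f mf f0).
rewrite integral_product_lawS; last 2 first.
- apply: mcat => //.
  exact: (measurableT_comp mf (@measurable_cat_tuple a.+1 b)).
- by move=> x; exact: integral_ge0.
apply: eq_integral => u _.
rewrite (IH (fun w => f (cons_pair (u, w)))); last 2 first.
- apply: (measurableT_comp mf).
  by apply: measurable_cons; [exact: measurable_cst|exact: measurable_id].
- by move=> w; exact: f0.
apply: eq_integral => x _; apply: eq_integral => y _; congr f; exact: val_inj.
Qed.

End integral_product_law.

Section product_law_kernel.
Local Open Scope ereal_scope.
Context d (T : measurableType d) (R : realType).

(** The parameter space [X] is quantified so that it may grow in the induction: the first coordinate
    of the tuple joins it, and the remaining factors are kernels on [X * T]. *)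
Lemma measurable_product_law_kernel m d0 (X : measurableType d0)
    (k : 'I_m -> X -> pprobability T R) (F : X * m.-tuple T -> \bar R) :
  (forall j, measurable_fun setT (k j)) ->
  measurable_fun setT F -> (forall z, 0 <= F z) ->
  measurable_fun setT
    (fun x => \int[product_law (fun j => k j x : probability T R)]_t F (x, t)).
Proof.
elim: m d0 X k F => [|m IH] d0 X k F mk mF F0.
  rewrite (_ : (fun _ => _) = fun x => F (x, [tuple])).
    by apply: (measurableT_comp mF); exact: measurable_pair2.
  apply/funext => x; rewrite integral_product_law0//.
  by apply: (measurableT_comp mF); exact: measurable_pair1.
pose G (z : X * T) := \int[product_law (fun j => k (lift ord0 j) z.1 : probability T R)]_s
  F (z.1, cons_pair (z.2, s)).
have mG : measurable_fun setT G.
  apply: (IH _ _ (fun j (z : X * T) => k (lift ord0 j) z.1)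
     (fun w : (X * T) * m.-tuple T => F (w.1.1, cons_pair (w.1.2, w.2)))) => //.
    by move=> j; exact: (measurableT_comp (mk (lift ord0 j)) measurable_fst).
  apply: (measurableT_comp mF); apply/measurable_fun_pairP; split => /=.
    exact: (measurableT_comp measurable_fst measurable_fst).
  apply: (measurableT_comp (@measurable_cons_pair _ T m)).
  apply/measurable_fun_pairP; split => /=; last exact: measurable_snd.
  exact: (measurableT_comp measurable_snd measurable_fst).
rewrite (_ : (fun _ => _) = fun x => \int[k ord0 x : probability T R]_y G (x, y)).
  apply: (measurable_fun_integral_finite_kernel G (kprobability (mk ord0))) => //.
  by move=> z; exact: integral_ge0.
apply/funext => x; rewrite integral_product_lawS//.
by apply: (measurableT_comp mF); exact: measurable_pair1.
Qed.

Context d' (Z : measurableType d').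

Lemma measurable_subtuple a n (r : 'I_a -> 'I_n) :
  measurable_fun setT (fun z : n.-tuple Z => [tuple tnth z (r i) | i < a]).
Proof.
apply/measurable_fun_tnthP => i.
rewrite (_ : _ \o _ = fun z => tnth z (r i)); first exact: measurable_tnth.
by apply/funext => z /=; rewrite tnth_mktuple.
Qed.

(* The servers read consecutive blocks of the sample, hence the transcripts
   are independent. *)
Lemma integral_product_law_blocks (P : probability Z R) m (n : 'I_m -> nat) (N : nat)
    (r : forall j, 'I_(n j) -> 'I_N)
    (K : forall j, {mfun (n j).-tuple Z >-> pprobability T R})
    (f : m.-tuple T -> \bar R) :
  N = (\sum_(j < m) n j)%N ->
  (forall j i, r j i = (\sum_(k < m | (k < j)%N) n k + i)%N :> nat) ->
  measurable_fun setT f -> (forall t, 0 <= f t) ->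
  \int[product_law (fun _ : 'I_N => P)]_z
    \int[product_law (fun j => K j [tuple tnth z (r j i) | i < n j] : probability T R)]_t
      f t =
  \int[product_law (fun j => mixture (product_law (fun _ : 'I_(n j) => P)) (K j))]_t f t.
Proof.
elim: m n N r K f => [|m IH] n N r K f NE rE mf f0.
  rewrite [RHS]integral_product_law0//.
  transitivity (\int[product_law (fun _ : 'I_N => P)]_z f [tuple]).
    by apply: eq_integral => z _; exact: integral_product_law0.
  rewrite integral_cst// -[RHS]mule1; congr (_ * _).
  exact: (@probability_setT _ _ _ (product_law (fun _ : 'I_N => P))).
pose n' (j : 'I_m) := n (lift ord0 j).
pose N' := (\sum_(j < m) n' j)%N.
have NE' : N = (n ord0 + N')%N by rewrite NE big_ord_recl.
move: NE r rE; rewrite NE' {N NE'} => _ r rE.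
have r0E i : r ord0 i = lshift N' i.
  by apply: val_inj; rewrite /= rE big_pred0.
have rS j i : (r (lift ord0 j) i = n ord0 + (\sum_(k < m | (k < j)%N) n' k + i) :> nat)%N.
  rewrite rE big_mkcond big_ord_recl/= addnA; congr (_ + _ + _)%N.
  by rewrite [RHS]big_mkcond.
have r'P (j : 'I_m) (i : 'I_(n' j)) : (\sum_(k < m | (k < j)%N) n' k + i < N')%N.
  by have := ltn_ord (r (lift ord0 j) i); rewrite rS ltn_add2l.
(* The positions read by the other servers, renumbered within the part of the sample that follows
   the first block. *)
pose r' j (i : 'I_(n' j)) : 'I_N' := Ordinal (r'P j i).
have r'E j i : r (lift ord0 j) i = rshift (n ord0) (r' j i).
  by apply: val_inj; rewrite /= rS.
pose K' j : {mfun (n' j).-tuple Z >-> pprobability T R} := K (lift ord0 j).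
have mK j : measurable_fun setT (fun z : (n ord0 + N').-tuple Z =>
    K j [tuple tnth z (r j i) | i < n j]).
  exact: (measurableT_comp (measurable_funPT (K j)) (measurable_subtuple (r j))).
have mK' j : measurable_fun setT (fun y : N'.-tuple Z =>
    K' j [tuple tnth y (r' j i) | i < n' j]).
  exact: (measurableT_comp (measurable_funPT (K' j)) (measurable_subtuple (r' j))).
rewrite integral_product_law_cat; last 2 first.
- apply: (measurable_product_law_kernel (F := fun w => f w.2) mK) => //.
  by apply: (measurableT_comp mf); exact: measurable_snd.
- by move=> z; exact: integral_ge0.
pose H (w : N'.-tuple Z * T) :=
  \int[product_law (fun j => K' j [tuple tnth w.1 (r' j i) | i < n' j] : probability T R)]_s
    f (cons_pair (w.2, s)).
have mH : measurable_fun setT H.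
  apply: (measurable_product_law_kernel
    (k := fun j (w : N'.-tuple Z * T) => K' j [tuple tnth w.1 (r' j i) | i < n' j])
    (F := fun w : (N'.-tuple Z * T) * m.-tuple T => f (cons_pair (w.1.2, w.2)))) => //.
    by move=> j; apply: (measurableT_comp (mK' j)); exact: measurable_fst.
  apply: (measurableT_comp mf); apply: (measurableT_comp (@measurable_cons_pair _ T m)).
  apply/measurable_fun_pairP; split => /=; last exact: measurable_snd.
  exact: (measurableT_comp measurable_snd measurable_fst).
have H0 w : 0 <= H w by exact: integral_ge0.
pose G t0 := \int[product_law (fun j => mixture (product_law (fun _ : 'I_(n' j) => P)) (K' j))]_s
  f (cons_pair (t0, s)).
have mG : measurable_fun setT G.
  apply: (@measurable_fun_fubini_tonelli_F _ _ _ _ R _ (fun w => f (cons_pair w))) => //.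
  exact: (measurableT_comp mf (@measurable_cons_pair _ T m)).
rewrite integral_product_lawS// -/(G _) integral_mixture//; last first.
  by move=> t0; exact: integral_ge0.
apply: eq_integral => x _.
transitivity (\int[product_law (fun _ : 'I_N' => P)]_y
    \int[K ord0 x : probability T R]_t0 H (y, t0)).
  apply: eq_integral => y _; rewrite integral_product_lawS//.
  rewrite (_ : [tuple _ | _ < n ord0] = x); last first.
    by apply: eq_from_tnth => i; rewrite tnth_mktuple r0E tnth_lshift.
  apply: eq_integral => t0 _; rewrite /H/=.
  congr (integral (product_law _)); apply/funext => j.
  congr (K _ _ : probability T R).
  by apply: eq_from_tnth => i; rewrite !tnth_mktuple r'E tnth_rshift.
(* Given the first block, the first transcript and the rest of the sample are independent.
   Exchanging the two integrals fixes the first transcript, and the induction hypothesis applies to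
   the other servers. *)
rewrite (@fubini_tonelli _ _ _ _ R (product_law (fun _ : 'I_N' => P)) (K ord0 x : probability T R) H mH H0)/=.
apply: eq_integral => t0 _.
rewrite /G -(IH n' N' r' K' (fun s => f (cons_pair (t0, s))))//.
apply: (measurableT_comp mf (f := f)).
by apply: measurable_cons; [exact: measurable_cst|exact: measurable_id].
Qed.

End product_law_kernel.

(** * The two-point bound *)

Section le_cam.
Context d (T : measurableType d) (R : realType).

Lemma ge0_integral_indicator_le (mu : probability T R) (b : T -> bool)
    (h : T -> R) (c : R) : measurable_fun setT b -> measurable_fun setT h ->
  (forall t, 0 <= h t) -> 0 <= c -> (forall t, b t -> c <= h t) ->
  ((c * \int[mu]_t (b t)%:R)%:E <= \int[mu]_t (h t)%:E)%E.
Proof.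
move=> mb mh h0 c0 bh.
have ub : unit_valued (fun t => (b t)%:R : R) by exact: unit_valued_bool.
rewrite EFinM EFin_mean; last exact: unit_valued_bounded.
rewrite -ge0_integralZl//; last by apply/measurable_EFinP; case: ub.
apply: ge0_le_integral => //.
- by move=> t _; rewrite lee_fin mulr_ge0// ler0n.
- by apply: measurable_funeM; apply/measurable_EFinP; case: ub.
- exact/measurable_EFinP.
- move=> t _; rewrite lee_fin; case: (boolP (b t)) => [/bh|_]; rewrite ?mulr1//.
  by rewrite mulr0.
Qed.

(** Test whether [|est|] is at least [|gamma| / 2]. If this has [mu]-probability at least
    [1 / (16 k)], the first risk is at least [gamma^2 / 4] times that. Otherwise the domination
    gives it [nu]-probability at most [1/4 + e <= 1/2], and on the complement [est] misses [gamma]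
    by at least [|gamma| / 2]. *)
Lemma two_point_lower_bound (mu nu : probability T R) (k e gamma : R) (est : T -> R) :
  1 <= k -> e <= 4^-1 -> chi2_dominated mu nu k e -> measurable_fun setT est ->
  ((gamma ^+ 2 / (64 * k))%:E <= \int[mu]_t ((est t - 0) ^+ 2)%:E)%E \/
  ((gamma ^+ 2 / (64 * k))%:E <= \int[nu]_t ((est t - gamma) ^+ 2)%:E)%E.
Proof.
move=> k1 e4 H mest.
have k0 : 0 < k by exact: lt_le_trans k1.
pose b t := `|gamma| / 2 <= `|est t|.
have mb : measurable_fun setT b.
  by apply: measurable_fun_ler => //; exact: measurableT_comp.
have ub : unit_valued (fun t => (b t)%:R : R) by exact: unit_valued_bool.
have := H _ ub.
have -> : \int[mu]_t ((b t)%:R ^+ 2) = \int[mu]_t (b t)%:R :> R.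
  by apply: eq_Rintegral => t _; case: (b t); rewrite ?expr1n ?expr0n.
have /andP[m0 _] := mean_unit_valued mu ub.
set m := \int[mu]_t _ in m0 * => Hm.
have g0 : 0 <= gamma ^+ 2 by exact: sqr_ge0.
have msq (c : R) : measurable_fun setT (fun t => (est t - c) ^+ 2).
  by apply: measurable_funX; exact: measurable_funB.
have [hm|hm] := leP ((16 * k)^-1) m; [left|right].
  apply: (@le_trans _ _ (gamma ^+ 2 / 4 * m)%:E).
    rewrite lee_fin (_ : gamma ^+ 2 / (64 * k) = gamma ^+ 2 / 4 * (16 * k)^-1).
      by rewrite ler_wpM2l// divr_ge0.
    by field; rewrite gt_eqF.
  apply: ge0_integral_indicator_le => //.
  - by move=> t; exact: sqr_ge0.
  - by rewrite divr_ge0.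
  - move=> t; rewrite /b subr0 => h.
    have : (`|gamma| / 2) ^+ 2 <= `|est t| ^+ 2 by rewrite lerXn2r ?nnegrE ?divr_ge0.
    by rewrite exprMn !real_normK ?num_real//; lra.
have hs : Num.sqrt (k * m) <= 4^-1.
  rewrite (_ : 4^-1 = Num.sqrt ((4^-1) ^+ 2) :> R); last by rewrite sqrtr_sqr ger0_norm.
  rewrite ler_wsqrtr//; have : k * m <= k * (16 * k)^-1 by rewrite ler_wpM2l ?ltW.
  by rewrite (_ : k * (16 * k)^-1 = (4^-1) ^+ 2)//; field; rewrite gt_eqF.
have hn : 2^-1 <= \int[nu]_t (~~ b t)%:R :> R.
  have -> : \int[nu]_t (~~ b t)%:R = \int[nu]_t (1 - (b t)%:R) :> R.
    by apply: eq_Rintegral => t _; case: (b t); rewrite /= ?subrr ?subr0.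
  rewrite meanB ?mean_cst; [|exact: bounded_measurable_cst|exact: unit_valued_bounded].
  by move: Hm; set n := \int[nu]_t _ => Hm; lra.
apply: (@le_trans _ _ (gamma ^+ 2 / 4 * \int[nu]_t (~~ b t)%:R)%:E).
  rewrite lee_fin; apply: (@le_trans _ _ (gamma ^+ 2 / 4 * 2^-1)).
    rewrite -mulrA ler_wpM2l// -invfM lef_pV2 ?posrE; lra.
  by rewrite ler_wpM2l// divr_ge0.
apply: ge0_integral_indicator_le => //.
- by apply: measurable_neg.
- by move=> t; exact: sqr_ge0.
- by rewrite divr_ge0.
- move=> t; rewrite /b -ltNge => h.
  have h2 : `|gamma| / 2 <= `|est t - gamma|.
    have := ler_normB (est t - gamma) (est t).
    rewrite (_ : est t - gamma - est t = - gamma) ?normrN; lra.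
  have : (`|gamma| / 2) ^+ 2 <= `|est t - gamma| ^+ 2.
    by rewrite lerXn2r ?nnegrE ?divr_ge0.
  by rewrite exprMn !real_normK ?num_real//; lra.
Qed.

End le_cam.

(** * Contribution of one server *)

Section server_bounds.
Context (R : realType) (S : design R) (P : protocol S) (f g : {mfun R >-> R}).
Variables (a b c : R).
Hypotheses (f0 : forall x, f x = 0) (a0 : 0 <= a) (b0 : 0 <= b).
Hypotheses (a1 : a ^+ 2 <= 2^-1) (ga : forall x, `|g x| <= a).
Hypothesis gc : forall x, g x != 0 -> c <= x <= c + b.

Definition transcript_law (h : {mfun R >-> R}) (j : 'I_(servers S)) :
    probability (transcript P) R :=
  mixture (product_law (fun _ : 'I_(nobs j) => obs_law h)) (mechanism P j).

Lemma risk_transcript_law x h : 0 <= x <= 1 ->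
  risk P x h = (\int[product_law (transcript_law h)]_t
    ((@estimator R S P t x - h x) ^+ 2)%:E)%E.
Proof.
move=> x01; rewrite -(@integral_product_law_blocks _ _ R _ _ (obs_law h) _ _
  (total_obs S) (fun j i => tagnat.Rank j i)
  (fun j => mechanism P j) (fun t => ((@estimator R S P t x - h x) ^+ 2)%:E))//.
- by move=> j i; rewrite tagnat.RankEsum.
- apply/measurable_EFinP/measurable_funX/measurable_funB => //.
  exact: measurable_estimator.
- by move=> t; rewrite lee_fin sqr_ge0.
Qed.

(** Privacy is disregarded: this is the bound for the raw sample, pushed through the mechanism. *)
Lemma chi2_dominated_public j :
  chi2_dominated (transcript_law f j) (transcript_law g j)
    (expR (2 * ((nobs j)%:R * (a ^+ 2 * b)))) 0.
Proof.
have ab0 : 0 <= a ^+ 2 * b by rewrite mulr_ge0// sqr_ge0.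
have ab1 : 0 <= 1 + 2 * (a ^+ 2 * b) by rewrite addr_ge0// mulr_ge0.
have K := chi2_dominated_product_law (fun _ : 'I_(nobs j) => ab1) (fun=> lexx 0)
  (fun=> chi2_dominated_obs_law f0 a0 b0 a1 ga gc).
rewrite prodr_const sumr_const card_ord mul0rn in K.
have H := chi2_dominated_mixture (mechanism P j) (exprn_ge0 _ ab1) K.
move=> u uu; apply: (le_trans (H u uu)); rewrite lerD2r ler_wsqrtr// ler_wpM2r//.
  by apply: Rintegral_ge0 => t _; rewrite sqr_ge0.
by rewrite [in leRHS]mulrCA [in leRHS]expRM_natl lerXn2r ?nnegrE ?expR_ge0 ?expR_ge1Dx.
Qed.

(** The factor of the one-at-a-time argument is at most [expR z], because
    [expR (eps j) - expR (- eps j)] is at most [2 * expR Ceps * eps j]. As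
    [expR z - 1 <= z * expR z], the bound [z <= Y] makes the excess linear in [z]. *)
Lemma chi2_dominated_private_server (Ceps Y : R) j :
  0 <= eps j <= Ceps -> 0 <= delta j ->
  (nobs j)%:R * (4 * (a * b) * expR Ceps * eps j) <= Y ->
  chi2_dominated (transcript_law f j) (transcript_law g j)
    (expR (expR (2 * Y) * ((nobs j)%:R * (4 * (a * b) * expR Ceps * eps j)) ^+ 2))
    (8 * expR Y * (a * b) * ((nobs j)%:R * delta j)).
Proof.
move=> /andP[e0 eC] d0; set z := _ * (_ * eps j) => zY.
have ab0 : 0 <= a * b by rewrite mulr_ge0.
have t0 : 0 <= 2 * (a * b) by rewrite mulr_ge0.
have z0 : 0 <= z by rewrite !mulr_ge0// expR_ge0.
have := chi2_dominated_private e0 d0 t0 (mechanism_private (p := P) (j := j))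
  (clamp_invariant_obs_law f) (clamp_invariant_obs_law g)
  (tv_dominated_obs_law f0 a0 b0 a1 ga gc)
  (tv_dominated_obs_law_sym f0 a0 b0 a1 ga gc).
set A := (1 + _) ^+ _ => H.
have expm1 (t : R) : expR t - 1 <= t * expR t.
  have := ler_wpM2l (expR_ge0 t) (expR_ge1Dx (- t)).
  by rewrite -expRD subrr expR0; lra.
have invE : (expR (eps j))^-1 = expR (- eps j) by rewrite expRN.
have diff : expR (eps j) - (expR (eps j))^-1 <= 2 * expR Ceps * eps j.
  rewrite invE; have h1 := expm1 (eps j); have h2 := expR_ge1Dx (- eps j).
  have h3 : expR (eps j) <= expR Ceps by rewrite ler_expR.
  have h4 := expR_ge1Dx Ceps.
  have h5 := ler_wpM2l e0 h3.
  have h6 := mulr_ge0 e0 (le_trans e0 eC); nra.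
have diff0 : 0 <= expR (eps j) - (expR (eps j))^-1.
  by rewrite invE subr_ge0 ler_expR; lra.
have Az : A <= expR z.
  rewrite /A /z expRM_natl lerXn2r ?nnegrE ?expR_ge0//.
    by rewrite addr_ge0// mulr_ge0.
  apply: le_trans (expR_ge1Dx _); rewrite lerD2l.
  by have := ler_wpM2l t0 diff; lra.
have A1 : 1 <= A by rewrite exprn_ege1// lerDl mulr_ge0.
have eY : expR z <= expR Y by rewrite ler_expR.
move=> u uu; apply: (le_trans (H u uu)); apply: lerD; last first.
  have nd : 0 <= (nobs j)%:R * delta j by rewrite mulr_ge0.
  have := ler_wpM2r (mulr_ge0 ab0 nd) (le_trans Az eY); lra.
rewrite ler_wsqrtr// ler_wpM2r//.
  by apply: Rintegral_ge0 => t _; rewrite sqr_ge0.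
apply: le_trans (expR_ge1Dx _); rewrite lerD2l.
have h1 : A - 1 <= expR Y * z.
  apply: (le_trans (lerB Az (lexx 1))); apply: (le_trans (expm1 z)).
  by rewrite mulrC ler_wpM2r.
rewrite expRM_natl -exprMn lerXn2r ?nnegrE ?subr_ge0//.
by rewrite mulr_ge0// expR_ge0.
Qed.

Lemma risk_lower_bound (x W : R) (k e : 'I_(servers S) -> R) : 0 <= x <= 1 ->
  (forall j, 0 <= e j) ->
  (forall j, chi2_dominated (transcript_law f j) (transcript_law g j) (expR (k j)) (e j)) ->
  0 <= W -> \sum_j k j <= W -> \sum_j e j <= 4^-1 ->
  ((g x ^+ 2 / (64 * expR W))%:E <= risk P x f)%E \/
  ((g x ^+ 2 / (64 * expR W))%:E <= risk P x g)%E.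
Proof.
move=> x01 e0 H W0 kW e4; rewrite !risk_transcript_law// f0.
have eW : 1 <= expR W by rewrite -expR0 ler_expR.
apply: (two_point_lower_bound (mu := product_law (transcript_law f))
  (nu := product_law (transcript_law g)) (g x) eW e4 _ (@measurable_estimator R S P x x01)).
have K := chi2_dominated_product_law (fun j => expR_ge0 (k j)) e0 H.
move=> u uu; apply: (le_trans (K u uu)); rewrite lerD2r ler_wsqrtr// ler_wpM2r//.
  by apply: Rintegral_ge0 => t _; rewrite sqr_ge0.
by rewrite -expR_sum ler_expR.
Qed.

End server_bounds.

(** * Balancing the bandwidth against the total information *)

Section bandwidth.
Context (R : realType) (S : design R) (P : protocol S) (f g : {mfun R >-> R}).
Variables (M nu h D c Ceps x : R).
Hypotheses (f0 : forall x, f x = 0) (M0 : 0 < M) (nu0 : 0 < nu) (h01 : 0 < h <= 1).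
Let a := M * h `^ nu.
Let b := M * h.
Hypotheses (a1 : a ^+ 2 <= 2^-1) (ga : forall x, `|g x| <= a).
Hypothesis gc : forall x, g x != 0 -> c <= x <= c + b.
Hypotheses (x01 : 0 <= x <= 1).
Hypotheses (heps : forall j : 'I_(servers S), 0 < eps j <= Ceps).
Hypothesis (hdelta : forall j : 'I_(servers S), 0 <= delta j).
Hypotheses (D0 : 0 < D) (hD : D * h <= 1).

Let information (j : 'I_(servers S)) :=
  Num.min ((nobs j)%:R ^+ 2 * eps j ^+ 2) ((nobs j)%:R * D).
Hypothesis DE : D `^ (2 * nu + 2) = \sum_j information j.

(** [Y] is the coefficient of [h^(nu + 1) n eps] in the private bound, and also bounds that whole
    quantity. The two summands of [W] compare the exponents of private and of public servers with
    their shares [information j / D^(2 nu + 2)]. *)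
Let Y := 4 * M ^+ 2 * expR Ceps.
Let W := expR (2 * Y) * Y ^+ 2 + 2 * M ^+ 3.
Hypothesis delta_small :
  8 * expR Y * M ^+ 2 * \sum_(j < servers S) (nobs j)%:R * delta j <= 4^-1.

Lemma risk_lower_bound_bandwidth :
  ((g x ^+ 2 / (64 * expR W))%:E <= risk P x f)%E \/
  ((g x ^+ 2 / (64 * expR W))%:E <= risk P x g)%E.
Proof.
have [h0 h1] := andP h01.
pose p1 := h `^ (2 * nu + 1); pose q1 := D `^ (2 * nu + 1).
pose p2 := h `^ (nu + 1); pose q2 := D `^ (nu + 1).
have pow1 r : 0 <= r -> h `^ r * D `^ r <= 1.
  move=> r0; apply: (@le_trans _ _ (1 `^ r)); last by rewrite powR1.
  rewrite -powRM; [|exact: ltW|exact: ltW].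
  apply: ge0_ler_powR; rewrite ?nnegrE //; last by rewrite mulrC.
  by rewrite mulr_ge0 ?ltW.
have pq1 : p1 * q1 <= 1 by apply: pow1; rewrite addr_ge0// mulr_ge0// ltW.
have pq2 : p2 * q2 <= 1 by apply: pow1; rewrite addr_ge0// ltW.
have p1_0 : 0 < p1 by exact: powR_gt0.
have p2_0 : 0 < p2 by exact: powR_gt0.
have q1_0 : 0 < q1 by exact: powR_gt0.
have q2_0 : 0 < q2 by exact: powR_gt0.
have hD0 : h != 0 by rewrite gt_eqF.
have DD0 : D != 0 by rewrite gt_eqF.
have DE1 : D `^ (2 * nu + 2) = q1 * D.
  rewrite /q1 -{3}(powRr1 (ltW D0)) -powRD ?DD0 ?implybT//; congr powR; lra.
have DE2 : D `^ (2 * nu + 2) = q2 ^+ 2.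
  rewrite /q2 expr2 -powRD ?DD0 ?implybT//; congr powR; lra.
have abE : a * b = M ^+ 2 * p2.
  rewrite /p2 powRD ?hD0 ?implybT// powRr1 ?ltW// /a /b; ring.
have a2bE : a ^+ 2 * b = M ^+ 3 * p1.
  rewrite /p1 (_ : 2 * nu + 1 = nu + nu + 1); last by lra.
  rewrite powRD ?hD0 ?implybT// powRD ?hD0 ?implybT// powRr1 ?ltW// /a /b; ring.
have p2_1 : p2 <= 1.
  by rewrite -(powRr0 h); apply: ger_powR; [rewrite h0|rewrite addr_ge0// ltW].
have a0 : 0 <= a by rewrite mulr_ge0 ?powR_ge0 ?ltW.
have b0 : 0 <= b by rewrite mulr_ge0 ?ltW.
have Y0 : 0 <= Y by apply: mulr_ge0 (expR_ge0 _); apply: mulr_ge0 (sqr_ge0 _).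
have M30 : 0 <= M ^+ 3 by rewrite exprn_ge0 ?ltW.
have W1 : expR (2 * Y) * Y ^+ 2 <= W by rewrite lerDl mulr_ge0.
have W2 : 2 * M ^+ 3 <= W by rewrite lerDr mulr_ge0 ?expR_ge0 ?sqr_ge0.
have W0 : 0 <= W by apply: le_trans W2; rewrite mulr_ge0.
pose n (j : 'I_(servers S)) : R := (nobs j)%:R.
have n0 j : 0 <= n j by rewrite /n.
have I0 j : 0 <= information j.
  by rewrite le_min mulr_ge0 ?sqr_ge0//= mulr_ge0// ltW.
have Ile j : information j <= q2 ^+ 2.
  by rewrite -DE2 DE (bigD1 j)//= lerDl sumr_ge0.
(* The bound used for a server is the one matching the smaller term of its minimum. *)
pose private (j : 'I_(servers S)) := n j ^+ 2 * eps j ^+ 2 <= n j * D.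
pose z j := n j * (4 * (a * b) * expR Ceps * eps j).
have zE j : z j = Y * (p2 * (n j * eps j)) by rewrite /z abE /Y; ring.
have Iprivate j : private j -> information j = (n j * eps j) ^+ 2.
  by move=> pj; rewrite /information min_l// exprMn.
have Ipublic j : ~~ private j -> information j = n j * D.
  by move=> /negbTE; rewrite /private leNgt => /negbFE pj; rewrite /information min_r// ltW.
have e0 (j : 'I_(servers S)) : 0 <= eps j by have /andP[/ltW] := heps j.
have zY j : private j -> z j <= Y.
  move=> pj; rewrite zE -[leRHS]mulr1 ler_wpM2l//.
  have nq : n j * eps j <= q2.
    have := Ile j; rewrite Iprivate// ler_sqr ?nnegrE ?mulr_ge0//; exact: ltW.
  exact: le_trans (ler_wpM2l (ltW p2_0) nq) pq2.
pose k j := if private j then expR (2 * Y) * z j ^+ 2 else 2 * (n j * (a ^+ 2 * b)).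
pose e j := if private j then 8 * expR Y * (a * b) * (n j * delta j) else 0.
have nd0 (j : 'I_(servers S)) : 0 <= n j * delta j by rewrite mulr_ge0.
have ab0 : 0 <= a * b by rewrite mulr_ge0.
have C0 : 0 <= 8 * expR Y * (a * b) by rewrite mulr_ge0// mulr_ge0// expR_ge0.
apply: (@risk_lower_bound R S P f g f0 x W k e) => //.
- by move=> j; rewrite /e; case: ifP => // _; rewrite mulr_ge0.
- move=> j; rewrite /k /e; case: (boolP (private j)) => pj.
    apply: (chi2_dominated_private_server f0 a0 b0 a1 ga gc) => //.
      by have /andP[/ltW -> ->] := heps j.
    exact: zY.
  exact: (chi2_dominated_public f0 a0 b0 a1 ga gc).
(* Here [q2 ^+ 2 = D^(2 nu + 2)] is the total information, so summing over the servers and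
   cancelling it bounds the sum of the [k j] by [W]. *)
- have kI j : k j * q2 ^+ 2 <= W * information j.
    rewrite /k; case: ifPn => pj.
      rewrite Iprivate// zE (exprMn _ Y) (exprMn _ p2) (exprMn _ (n j)).
      have pq : p2 ^+ 2 * q2 ^+ 2 <= 1.
        by rewrite -(exprMn _ p2) expr_le1// mulr_ge0 ?ltW.
      have nn : 0 <= n j ^+ 2 * eps j ^+ 2 by rewrite mulr_ge0 ?sqr_ge0.
      apply: le_trans (ler_wpM2r nn W1).
      rewrite (_ : _ * q2 ^+ 2 = expR (2 * Y) * Y ^+ 2 * (n j ^+ 2 * eps j ^+ 2) *
        (p2 ^+ 2 * q2 ^+ 2)); last by ring.
      by rewrite ler_piMr// mulr_ge0// mulr_ge0 ?expR_ge0 ?sqr_ge0.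
    rewrite Ipublic// -DE2 DE1 a2bE.
    have nD : 0 <= n j * D by rewrite mulr_ge0// ltW.
    apply: le_trans (ler_wpM2r nD W2).
    rewrite (_ : _ * (q1 * D) = 2 * M ^+ 3 * (n j * D) * (p1 * q1)); last by ring.
    by rewrite ler_piMr// mulr_ge0// mulr_ge0.
  rewrite -(ler_pM2r (exprn_gt0 2 q2_0)) -{2}DE2 DE mulr_suml mulr_sumr.
  exact: ler_sum.
- apply: le_trans delta_small; rewrite mulr_sumr; apply: ler_sum => j _.
  have ab1 : a * b <= M ^+ 2 by rewrite abE ler_piMr ?sqr_ge0.
  have nde : 0 <= 8 * expR Y * (n j * delta j) by rewrite mulr_ge0// mulr_ge0// expR_ge0.
  rewrite /e; case: ifP => _; first by have := ler_wpM2l nde ab1; lra.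
  by rewrite mulr_ge0// mulr_ge0 ?sqr_ge0// mulr_ge0// expR_ge0.
Qed.

End bandwidth.

(** * Father and mother wavelets *)

Section rintegral.
Context (R : realType).
Local Notation leb := (@lebesgue_measure R).
Implicit Types (u v : R -> R) (s c : R).

Lemma Rintegral_lsum d (T : measurableType d) (mu : {measure set T -> \bar R})
    (D : set T) n (c : 'I_n -> R) (u : 'I_n -> T -> R) : measurable D ->
  (forall i, mu.-integrable D (EFin \o u i)) ->
  mu.-integrable D (EFin \o (fun x => \sum_i c i * u i x)) /\
  \int[mu]_(x in D) (\sum_i c i * u i x) = \sum_i c i * \int[mu]_(x in D) u i x.
Proof.
move=> mD; elim: n c u => [|n IH] c u iu.
  rewrite big_ord0 (_ : (fun _ => _) = cst 0); last by apply/funext => x; rewrite big_ord0.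
  split; last by rewrite /Rintegral integral0.
  exact: (integrable0 mu D).
have [i1 e1] := IH (fun i => c (lift ord0 i)) (fun i => u (lift ord0 i)) (fun i => iu _).
have -> : (fun x => \sum_i c i * u i x) = (fun x => c ord0 * u ord0 x +
    \sum_i c (lift ord0 i) * u (lift ord0 i) x).
  by apply/funext => x; rewrite big_ord_recl.
have i0 : mu.-integrable D (EFin \o (fun x => c ord0 * u ord0 x)).
  exact: (integrableZl mD (c ord0) (iu ord0)).
split; first exact: (integrableD mD i0 i1).
by rewrite RintegralD// RintegralZl// e1 big_ord_recl.
Qed.

Definition compactly_supported u := exists K : R, forall x, u x != 0 -> `|x| <= K.

Lemma compactly_supported_integrable u : continuous u -> compactly_supported u ->
  leb.-integrable setT (EFin \o u).
Proof.
move=> cu [K uK].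
rewrite (_ : EFin \o u = (EFin \o u) \_ (`[- K, K]%classic : set R)).
  apply: (iffLR (integrable_mkcond (mu := leb) (EFin \o u)
    (measurable_itv `[(- K), K]))).
  apply: continuous_compact_integrable; first exact: segment_compact.
  exact: continuous_subspaceT.
apply/funext => x; rewrite patchE; case: ifPn => //.
rewrite notin_setE/= in_itv/= -ler_norml => h.
by have [->|/uK] := eqVneq (u x) 0.
Qed.

Lemma compactly_supported_affine u s c : 0 < s -> compactly_supported u ->
  compactly_supported (fun x => u (s * x + c)).
Proof.
move=> s0 [K uK]; exists (s^-1 * (K + `|c|)) => x /uK h.
rewrite ler_pdivlMl// -{1}(gtr0_norm s0) -normrM -(addrK c (s * x)).
by rewrite (le_trans (ler_normB _ _))// lerD.
Qed.

Lemma compactly_supportedM u v : compactly_supported u ->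
  compactly_supported (fun x => u x * v x).
Proof. by move=> [K uK]; exists K => x; rewrite mulf_eq0 negb_or => /andP[/uK]. Qed.

Lemma continuous_affine u s c : continuous u -> continuous (fun x => u (s * x + c)).
Proof.
move=> cu x; apply: (@continuous_comp _ _ _ (fun x : R => s * x + c : R) u); last exact: cu.
apply: cvgD; last exact: cvg_cst.
by apply: cvgM; [exact: cvg_cst|exact: cvg_id].
Qed.

Lemma continuous_translate u c : continuous u -> continuous (fun x => u (x - c)).
Proof.
move=> cu; under eq_fun do rewrite -[X in X - _]mul1r.
exact: continuous_affine.
Qed.

Lemma compactly_supported_translate u c : compactly_supported u ->
  compactly_supported (fun x => u (x - c)).
Proof.
move=> cu; under eq_fun do rewrite -[X in X - _]mul1r.
exact: compactly_supported_affine.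
Qed.

Lemma Rintegral_affine u s c : 0 < s -> leb.-integrable setT (EFin \o u) ->
  \int[leb]_x u (s * x + c) = s^-1 * \int[leb]_x u x.
Proof.
move=> s0 iu; have mu : measurable_fun (setT : set (measurableTypeR R)) (EFin \o u).
  exact: (measurable_int leb).
have mp := measurable_funepos mu; have mn := measurable_funeneg mu.
have ep := ge0_integral_affine c s0 mp (funepos_ge0 _).
have en := ge0_integral_affine c s0 mn (funeneg_ge0 _).
have fp := integrable_pos_fin_num measurableT iu.
have fn := integrable_neg_fin_num measurableT iu.
rewrite /Rintegral.
have eL : (\int[leb]_x (u x)%:E =
    \int[leb]_x (EFin \o u)^\+ x - \int[leb]_x (EFin \o u)^\- x)%E.
  exact: integralE.
have eR : (\int[leb]_x (u (s * x + c))%:E =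
    \int[leb]_x (EFin \o u)^\+ (s * x + c)%R -
    \int[leb]_x (EFin \o u)^\- (s * x + c)%R)%E.
  rewrite integralE; congr (_ - _)%E; apply: eq_integral => x _.
    by rewrite -[RHS]/(((EFin \o u)^\+ \o (fun x => (s * x + c)%R)) x)%E -funepos_comp.
  by rewrite -[RHS]/(((EFin \o u)^\- \o (fun x => (s * x + c)%R)) x)%E -funeneg_comp.
rewrite eL eR ep en; move: fp fn; rewrite ep en.
set a := (\int[_]_x _)%E; set b := (\int[_]_x _)%E.
have sE : (0 < s%:E)%E by rewrite lte_fin.
(* The parts of [u] have finite integrals, which [ep] and [en] express as [s] times the rescaled
   ones; infinite values are thereby excluded. *)
case: a => [r| |]; rewrite ?(gt0_muley sE, gt0_muleNy sE)// => _.
case: b => [t| |]; rewrite ?(gt0_muley sE, gt0_muleNy sE)// => _ /=.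
by rewrite -mulrBr mulKf// gt_eqF.
Qed.

End rintegral.

Section daubechies_orthogonality.
Context (R : realType) (N : nat) (phi psi : R -> R) (hf : 'I_(2 * N) -> R).
Local Notation leb := (@lebesgue_measure R).
Hypothesis cphi : continuous phi.
Hypothesis sphi : forall x, phi x != 0 -> 1 - N%:R <= x <= N%:R.
Hypothesis ophi : forall k : int, \int[leb]_x (phi x * phi (x - k%:~R)) = (k == 0)%:R.
Hypothesis rphi : forall x, phi x = Num.sqrt 2 *
  \sum_(i < 2 * N) hf i * phi (2 * x - (i%:R - (N%:R - 1))).
Hypothesis rpsi : forall x, psi x = Num.sqrt 2 *
  \sum_(i < 2 * N) (-1) ^+ (i + N.+1) * hf (rev_ord i) *
    phi (2 * x - (i%:R - (N%:R - 1))).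

(** The place of the filter coefficient [i] on the integers, from [1 - N] to [N]. *)
Definition tap (i : nat) : int := i%:Z - (N%:Z - 1).

Lemma tapE i : (tap i)%:~R = i%:R - (N%:R - 1) :> R.
Proof. by rewrite /tap !rmorphB. Qed.

Lemma father_compactly_supported : compactly_supported phi.
Proof.
exists N%:R => x /sphi/andP[h1 h2]; rewrite ler_norml h2 andbT.
by apply: le_trans h1; rewrite lerDr.
Qed.

Lemma father_product_integrable s c s' c' : 0 < s ->
  leb.-integrable setT (EFin \o (fun x => phi (s * x + c) * phi (s' * x + c'))).
Proof.
move=> s0; apply: compactly_supported_integrable.
  by move=> x; apply: cvgM; exact: continuous_affine.
apply: compactly_supportedM.
exact: (compactly_supported_affine _ s0 father_compactly_supported).
Qed.

Lemma father_orthonormal2 (p q : int) :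
  \int[leb]_x (phi (2 * x - p%:~R) * phi (2 * x - q%:~R)) = 2^-1 * (p == q)%:R.
Proof.
have i1 := @father_product_integrable 1 0 1 (- (q - p)%:~R) ltr01.
rewrite eq_sym -subr_eq0 -ophi.
have -> : \int[leb]_x (phi x * phi (x - (q - p)%:~R)) =
    \int[leb]_x (phi (1 * x + 0) * phi (1 * x + - (q - p)%:~R)).
  by apply: eq_Rintegral => x _; rewrite !mul1r addr0.
rewrite -(Rintegral_affine (- p%:~R) (ltr0Sn R 1) i1).
apply: eq_Rintegral => x _; rewrite !mul1r addr0; congr (_ * phi _).
by rewrite rmorphB/=; ring.
Qed.

Let g (i : 'I_(2 * N)) := (-1) ^+ (i + N.+1) * hf (rev_ord i).

(* The involution (i, j) -> (rev j, rev i) of the double sum preserves i - j and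
   changes the sign of each term. *)
Lemma filter_cancellation (k k' : int) :
  \sum_i hf i * \sum_j g j * (2 * k + tap i == 2 * k' + tap j)%:R = 0 :> R.
Proof.
pose F (i j : 'I_(2 * N)) := hf i * (g j * (2 * k + tap i == 2 * k' + tap j)%:R).
have -> : \sum_i hf i * \sum_j g j * (2 * k + tap i == 2 * k' + tap j)%:R =
    \sum_i \sum_j F i j.
  by apply: eq_bigr => i _; rewrite mulr_sumr.
have FE i j : F (rev_ord j) (rev_ord i) = - F i j.
  rewrite /F /g rev_ordK.
  have ltj := ltn_ord j; have lti := ltn_ord i.
  have -> : (2 * k + tap (rev_ord j) == 2 * k' + tap (rev_ord i)) =
      (2 * k + tap i == 2 * k' + tap j).
    by rewrite /tap /=; apply/eqP/eqP; lia.
  case: eqP => [kij|_]; last by rewrite !mulr0 oppr0.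
  have sgn : (-1) ^+ (rev_ord i + N.+1) = - (-1) ^+ (j + N.+1) :> R.
    rewrite -signr_odd -[in RHS]signr_odd.
    have -> : odd (rev_ord i + N.+1) = ~~ odd (j + N.+1).
      by move: kij; rewrite /tap /=; lia.
    by case: (odd _); rewrite ?expr0 ?expr1 ?opprK.
  by rewrite sgn; ring.
have : \sum_i \sum_j F i j = - \sum_i \sum_j F i j.
  rewrite -sumrN exchange_big/= (reindex_inj rev_ord_inj)/=.
  apply: eq_bigr => i _; rewrite -sumrN (reindex_inj rev_ord_inj)/=.
  by apply: eq_bigr => j _; rewrite FE.
lra.
Qed.

(** The two refinement equations reduce the integral to translates of [phi] at half scale. These are
    orthogonal, so only the filter sum that cancels remains. *)
Lemma father_mother_orthogonal0 (k k' : int) :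
  \int[leb]_x (phi (x - k%:~R) * psi (x - k'%:~R)) = 0.
Proof.
pose w (i j : 'I_(2 * N)) x := phi (2 * x - (2 * k + tap i)%:~R) *
  phi (2 * x - (2 * k' + tap j)%:~R).
have iw i j : leb.-integrable setT (EFin \o w i j).
  exact: (@father_product_integrable 2 (- _) 2 (- _)).
have E x : phi (x - k%:~R) * psi (x - k'%:~R) =
    \sum_i (2 * hf i) * \sum_j g j * w i j x.
  rewrite rphi rpsi mulrACA -expr2 sqr_sqrtr// mulr_suml mulr_sumr.
  apply: eq_bigr => i _; rewrite -!mulrA; congr (_ * (_ * _)).
  rewrite mulr_sumr; apply: eq_bigr => j _; rewrite /w mulrCA; congr (_ * (phi _ * phi _)).
    by rewrite rmorphD/= rmorphM/= tapE; ring.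
  by rewrite rmorphD/= rmorphM/= tapE; ring.
have L i := Rintegral_lsum g measurableT (iw i).
under eq_Rintegral do rewrite E.
have [_ ->] := Rintegral_lsum (fun i => 2 * hf i) measurableT (fun i => (L i).1).
rewrite -[RHS](filter_cancellation k k').
apply: eq_bigr => i _; rewrite (L i).2 (mulrC 2) -mulrA; congr (_ * _).
by rewrite mulr_sumr; apply: eq_bigr => j _; rewrite father_orthonormal2; field.
Qed.

(** Refining [phi] alone and substituting [2 x] lowers the gap [d] between the two scales by one. *)
Lemma father_mother_orthogonal (d : nat) (k k' : int) : continuous psi ->
  \int[leb]_x (phi (x - k%:~R) * psi (2 ^+ d * x - k'%:~R)) = 0.
Proof.
move=> cpsi; elim: d k k' => [|d IH] k k'.
  rewrite -[RHS](father_mother_orthogonal0 k k').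
  by apply: eq_Rintegral => x _; rewrite expr0 mul1r.
pose v i y := phi (y - (2 * k + tap i)%:~R) * psi (2 ^+ d * y - k'%:~R).
have iv i : leb.-integrable setT (EFin \o v i).
  apply: compactly_supported_integrable.
    move=> y; apply: cvgM; last exact: continuous_affine.
    exact: continuous_translate.
  apply: compactly_supportedM.
  exact: compactly_supported_translate father_compactly_supported.
have iv2 i : leb.-integrable setT (EFin \o (fun x => v i (2 * x + 0))).
  apply: compactly_supported_integrable.
    apply: continuous_affine => y; apply: cvgM; last exact: continuous_affine.
    exact: continuous_translate.
  apply: compactly_supported_affine => //.
  apply: compactly_supportedM.
  exact: compactly_supported_translate father_compactly_supported.
have E x : phi (x - k%:~R) * psi (2 ^+ d.+1 * x - k'%:~R) =
    \sum_(i < 2 * N) (Num.sqrt 2 * hf i) * v i (2 * x + 0).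
  rewrite rphi mulr_sumr mulr_suml; apply: eq_bigr => i _.
  rewrite /v addr0 -!mulrA; congr (_ * (_ * (phi _ * psi _))).
    by rewrite rmorphD/= rmorphM/= tapE; ring.
  by rewrite exprSr; ring.
under eq_Rintegral do rewrite E.
have [_ ->] := Rintegral_lsum (fun i => Num.sqrt 2 * hf i) measurableT iv2.
apply: big1 => i _.
by rewrite (Rintegral_affine 0 (ltr0Sn R 1) (iv i)) IH !mulr0.
Qed.

End daubechies_orthogonality.

Lemma continuous_sum_ord (R : realType) n (u : 'I_n -> R -> R) :
  (forall i, continuous (u i)) -> continuous (fun x => \sum_i u i x).
Proof.
elim: n u => [|n IH] u cu; under eq_fun do rewrite ?big_ord0 ?big_ord_recl.
  by move=> x; exact: cvg_cst.
by move=> x; apply: cvgD; [exact: cu|apply: IH => i; exact: cu].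
Qed.

Section father_nonvanishing.
Context (R : realType) (N : nat) (phi : R -> R) (hf : 'I_(2 * N) -> R).
Local Notation leb := (@lebesgue_measure R).
Hypothesis cphi : continuous phi.
Hypothesis sphi : forall x, phi x != 0 -> 1 - N%:R <= x <= N%:R.
Hypothesis iphi : \int[leb]_x phi x = 1.
Hypothesis rphi : forall x, phi x = Num.sqrt 2 *
  \sum_(i < 2 * N) hf i * phi (2 * x - (i%:R - (N%:R - 1))).

(* By the refinement equation the common zeros of the integer translates are
   stable under halving and integer shifts, hence they would be dense. *)
Lemma father_nonvanishing (y : R) : exists k : int, phi (y - k%:~R) != 0.
Proof.
apply/not_existsP => Z0.
have Z (k : int) : phi (y - k%:~R) = 0 by apply/eqP/negP => /negP; exact: Z0.
have {Z0}dyadic (n : nat) (j : int) : phi ((y + j%:~R) / 2 ^+ n) = 0.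
  elim: n j => [|n IH] j; first by have := Z (- j); rewrite rmorphN/= opprK expr0 divr1.
  rewrite rphi big1 ?mulr0// => i _.
  rewrite (_ : 2 * _ - _ = (y + (j - 2 ^+ n * tap N i)%:~R) / 2 ^+ n).
    by rewrite IH mulr0.
  rewrite rmorphB rmorphM/= tapE rmorphXn/= exprS.
  by field; rewrite expf_neq0//=.
have phi0 (x : R) : phi x = 0.
  pose u (n : nat) : R := (y + (Num.floor (x * 2 ^+ n - y))%:~R) / 2 ^+ n.
  have ux : u n @[n --> \oo] --> x.
    have lim0 : (x - (1 / 2) ^+ n : R) @[n --> \oo] --> x.
      rewrite -[X in _ --> X]subr0; apply: cvgB; first exact: cvg_cst.
      by apply: cvg_expr; rewrite ger0_norm; lra.
    apply: (@squeeze_cvgr _ _ _ _ (fun n => x - (1 / 2) ^+ n) (fun=> x)) => //; last exact: cvg_cst.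
    near=> n; have p0 : (0 : R) < 2 ^+ n by rewrite exprn_gt0.
    have := floor_le (x * 2 ^+ n - y); have := lt_succ_floor (x * 2 ^+ n - y).
    rewrite /u ler_pdivrMr// ler_pdivlMr// mulrBl expr_div_n expr1n div1r mulVf ?gt_eqF//.
    rewrite rmorphD/=; lra.
  have /cvg_lim <-// : phi (u n) @[n --> \oo] --> phi x.
    exact: (@cvg_comp _ _ _ u phi _ _ _ ux (@cphi x)).
  by under eq_fun do rewrite dyadic; rewrite lim_cst.
have := iphi; under eq_Rintegral do rewrite phi0.
by rewrite Rintegral_cst// mul0r => /eqP; rewrite eq_sym oner_eq0.
Unshelve. all: by end_near. Qed.

(** On [0,1] only the [2 N + 1] translates in [F] can be nonzero, so [F] is positive there, and by
    compactness it has a positive minimum. Some term is at least the average, and integer shifts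
    carry this to every [y]. *)
Lemma father_lower_bound : exists c : R, 0 < c /\
  forall y, exists k : int, c <= `|phi (y - k%:~R)|.
Proof.
pose F (y : R) : R := \sum_(i < (2 * N).+1) `|phi (y - (i%:Z - N%:Z)%:~R)|.
have cF : continuous F.
  apply: continuous_sum_ord => i y; apply: cvg_norm.
  exact: continuous_translate.
have F0 (y : R) : 0 <= y <= 1 -> 0 < F y.
  move=> /andP[y0 y1]; have [k phik] := father_nonvanishing y.
  have /andP[h1 h2] := sphi phik.
  have k1 : - N%:Z <= k by rewrite -(ler_int R) rmorphN/=; lra.
  have k2 : k <= N%:Z by rewrite -(ler_int R) /=; lra.
  have ki : (absz (k + N%:Z)%R < (2 * N).+1)%N by lia.
  rewrite /F (bigD1 (Ordinal ki))//= ltr_wpDr ?sumr_ge0// normr_gt0.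
  by rewrite (_ : Posz (absz (k + N%:Z)) - N%:Z = k)//; lia.
have [c c01 Fc] := @EVT_min R F 0 1 ler01 (continuous_subspaceT cF).
exists (F c / (2 * N).+1%:R); split; first by rewrite divr_gt0 ?F0.
move=> y; pose m := Num.floor y; pose z := y - m%:~R.
have z01 : z \in `[0, 1].
  have := floor_le y; have := lt_succ_floor y.
  by rewrite in_itv/= rmorphD/= /z -/m => h1 h2; lra.
have FcN : F c <= \sum_(i < (2 * N).+1) `|phi (z - (i%:Z - N%:Z)%:~R)| := Fc _ z01.
apply: contrapT => /forallNP noK.
have : \sum_(i < (2 * N).+1) `|phi (z - (i%:Z - N%:Z)%:~R)| < F c.
  have -> : F c = \sum_(i < (2 * N).+1) (F c / (2 * N).+1%:R).
    by rewrite sumr_const card_ord -[RHS]mulr_natr divfK// pnatr_eq0.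
  apply: ltr_sum => [|i _]; first by apply/hasP; exists ord0; rewrite ?mem_index_enum.
  have := noK (m + (i%:Z - N%:Z)) => /negP.
  by rewrite -ltNge rmorphD/= opprD addrA.
by rewrite ltNge FcN.
Qed.

End father_nonvanishing.

(** * Besov norms *)

Section bessel.
Context (R : realType).
Local Notation leb := (@lebesgue_measure R).
Implicit Types (f g : R -> R).

Lemma continuous_integrable01 f : continuous f ->
  leb.-integrable `[0, 1] (EFin \o f).
Proof.
move=> cf; apply: continuous_compact_integrable; first exact: segment_compact.
exact: continuous_subspaceT.
Qed.

Lemma continuous_mul f g : continuous f -> continuous g ->
  continuous (fun x => f x * g x).
Proof. by move=> cf cg x; apply: cvgM; [exact: cf|exact: cg]. Qed.

Lemma inner01_eq f f' g g' : (forall x, 0 <= x <= 1 -> f x = f' x) ->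
  (forall x, 0 <= x <= 1 -> g x = g' x) -> inner01 f g = inner01 f' g'.
Proof.
move=> ff' gg'; apply: eq_Rintegral => x; rewrite inE/= in_itv/= => x01.
by rewrite ff'// gg'.
Qed.

Lemma inner01_suml n (c : 'I_n -> R) (u : 'I_n -> R -> R) g :
  (forall i, continuous (u i)) -> continuous g ->
  inner01 (fun x => \sum_i c i * u i x) g = \sum_i c i * inner01 (u i) g.
Proof.
move=> cu cg; have iu i : leb.-integrable `[0, 1] (EFin \o (fun x => u i x * g x)).
  by apply: continuous_integrable01; exact: continuous_mul.
have m01 : measurable (`[0, 1]%classic : set (measurableTypeR R)) by exact: measurable_itv.
rewrite -(Rintegral_lsum c m01 iu).2.
by apply: eq_Rintegral => x _; rewrite mulr_suml; apply: eq_bigr => i _; rewrite mulrA.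
Qed.

Lemma inner01C f g : inner01 f g = inner01 g f.
Proof. by apply: eq_Rintegral => x _; rewrite mulrC. Qed.

Lemma bessel_inequality n (u : 'I_n -> R -> R) f : continuous f ->
  (forall i, continuous (u i)) ->
  (forall i j, inner01 (u i) (u j) = (i == j)%:R) ->
  \sum_i inner01 f (u i) ^+ 2 <= inner01 f f.
Proof.
move=> cf cu ou; pose c i := inner01 f (u i); pose g x := \sum_i c i * u i x.
have cg : continuous g.
  rewrite /g; elim: n u c {ou g} cu => [|n IH] u c cu.
    by under eq_fun do rewrite big_ord0; move=> x; exact: cvg_cst.
  under eq_fun do rewrite big_ord_recl; move=> x; apply: cvgD; last by apply: IH.
  by apply: cvgM; [exact: cvg_cst|exact: cu].
have gu j : inner01 g (u j) = c j.
  rewrite inner01_suml// (bigD1 j)//= ou eqxx mulr1 big1 ?addr0// => i ij.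
  by rewrite ou (negbTE ij) mulr0.
have gf : inner01 g f = \sum_i c i ^+ 2.
  by rewrite inner01_suml//; apply: eq_bigr => i _; rewrite inner01C expr2.
have gg : inner01 g g = \sum_i c i ^+ 2.
  by rewrite inner01_suml//; apply: eq_bigr => i _; rewrite inner01C gu expr2.
have ii (h h' : R -> R) : continuous h -> continuous h' ->
    leb.-integrable `[0, 1] (EFin \o (fun x => h x * h' x)).
  by move=> ch ch'; apply: continuous_integrable01; exact: continuous_mul.
have m01 : measurable (`[0, 1]%classic : set (measurableTypeR R)) by exact: measurable_itv.
have : 0 <= \int[leb]_(x in `[0, 1]) ((f x * f x - 2 * (g x * f x)) + g x * g x).
  by apply: Rintegral_ge0 => x _; have := sqr_ge0 (f x - g x); lra.
have i2 : leb.-integrable `[0, 1] (EFin \o (fun x => 2 * (g x * f x))).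
  exact: (integrableZl m01 2 (ii g f cg cf)).
rewrite RintegralD//; [|exact: (integrableB m01 (ii _ _ cf cf) i2)|exact: ii].
rewrite RintegralB//; [|exact: ii].
rewrite RintegralZl//; [|exact: ii].
rewrite -/(inner01 f f) -/(inner01 g f) -/(inner01 g g) gf gg /c; lra.
Qed.

End bessel.

Section besov_bounds.
Context (R : realType).

Lemma lp_norm_ge0 (p : \bar R) n (v : 'I_n -> R) : 0 <= lp_norm p v.
Proof.
by case: p => [r| |]/=; rewrite ?powR_ge0//;
  elim/big_ind: _ => // x y x0 y0; rewrite le_max x0.
Qed.

(** Every entry is at most [B] in absolute value, so for finite [r >= 2] its power [r] is at most
    its square times [B^(r - 2)]. *)
Lemma lp_norm_le (p : \bar R) n (v : 'I_n -> R) (B : R) : (2%:E <= p)%E -> 0 <= B ->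
  \sum_i v i ^+ 2 <= B ^+ 2 -> lp_norm p v <= B.
Proof.
move=> p2 B0 vB; have vi i : `|v i| <= B.
  rewrite -ler_sqr ?nnegrE// real_normK ?num_real// (le_trans _ vB)//.
  by rewrite (bigD1 i)//= lerDl sumr_ge0// => j _; exact: sqr_ge0.
have maxB : \big[Num.max/0]_(k < n) `|v k| <= B.
  by elim/big_ind: _ => // x y xB yB; rewrite ge_max xB.
case: p p2 => [r| |]//=; rewrite lee_fin => r2.
have r0 : 0 < r by lra.
have S : \sum_(k < n) `|v k| `^ r <= B `^ r.
  have rE : r = 2 + (r - 2) by lra.
  have pw x : 0 <= x -> x `^ r = x ^+ 2 * x `^ (r - 2).
    rewrite le_eqVlt => /predU1P[<-|x0].
      by rewrite powR0 ?gt_eqF// expr0n/= mul0r.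
    rewrite {1}rE (@powRD _ x 2 (r - 2)); last by rewrite (gt_eqF x0) implybT.
    by rewrite (powR_mulrn 2 (ltW x0)).
  rewrite pw//; apply: (@le_trans _ _ (\sum_(k < n) v k ^+ 2 * B `^ (r - 2))).
    apply: ler_sum => k _; rewrite pw// real_normK ?num_real//.
    rewrite ler_wpM2l ?sqr_ge0//; apply: ge0_ler_powR; rewrite ?nnegrE//; lra.
  by rewrite -mulr_suml ler_wpM2r// powR_ge0.
apply: (@le_trans _ _ ((B `^ r) `^ r^-1)).
  apply: ge0_ler_powR; rewrite ?nnegrE ?invr_ge0 ?powR_ge0 ?(ltW r0)//.
  by apply: sumr_ge0 => k _; exact: powR_ge0.
by rewrite -powRrM divff ?gt_eqF// powRr1.
Qed.

(** Telescoping: for [l < L] the term is [G l.+1 - G l], and truncated subtraction makes [G] equal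
    to 1 from [L] on. *)
Lemma geometric_decay_sum (L n : nat) :
  \sum_(l < n) (if (l < L)%N then 2^-1 ^+ (L - l) else 0 : R) <= 1.
Proof.
pose G l : R := 2^-1 ^+ (L - l).
have h : \sum_(l < n) (if (l < L)%N then 2^-1 ^+ (L - l) else 0 : R) <= G n - G 0%N.
  elim: n => [|n IH]; first by rewrite big_ord0 subrr.
  rewrite big_ord_recr/=; case: ltnP => nL.
    rewrite (_ : G n.+1 - _ = (G n - G 0%N) + G n) ?lerD//.
    rewrite /G (_ : (L - n)%N = (L - n.+1).+1) ?exprS; last by rewrite subnSK.
    by field.
  rewrite addr0 (le_trans IH)// /G.
  by have [-> ->] : ((L - n)%N = 0%N) /\ ((L - n.+1)%N = 0%N) by lia.
apply: (le_trans h); rewrite lerBlDr (@le_trans _ _ 1)//; first by rewrite exprn_ile1//; lra.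
by rewrite lerDl exprn_ge0//; lra.
Qed.

(** The hypothesis makes the coefficients vanish from level [L] on and lets the weighted norms decay
    geometrically below it. The decay factors [t] lie in [0,1], so [t^r <= t] for every finite
    exponent [r >= 1], and one geometric sum serves them all. *)
Lemma besov_norm_le (alpha B : R) (p q : \bar R) (l0 L : nat) (w : nat -> nat -> R -> R)
    (f : R -> R) : (2%:E <= p)%E -> (1%:E <= q)%E -> 0 <= B ->
  (forall l, (l0 <= l)%N ->
    \sum_(k < level_size l0 l) inner01 f (w l k) ^+ 2 <=
    (B * (if (l < L)%N then 2^-1 ^+ (L - l) else 0) /
       2 `^ (l%:R * (alpha + 2^-1 - inv_exponent p))) ^+ 2) ->
  (besov_norm alpha p q l0 w f <= B%:E)%E.
Proof.
move=> p2 q1 B0 H; pose b l : R := 2 `^ (l%:R * (alpha + 2^-1 - inv_exponent p)) *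
  lp_norm p (fun k : 'I_(level_size l0 l) => inner01 f (w l k)).
have -> : besov_norm alpha p q l0 w f =
    if q is r%:E then poweR (\sum_(l0 <= l <oo) (b l `^ r)%:E)%E r^-1
    else ereal_sup [set (b l)%:E | l in [set l | (l0 <= l)%N]] by [].
pose t l : R := if (l < L)%N then 2^-1 ^+ (L - l) else 0.
have t0 l : 0 <= t l by rewrite /t; case: ifP => // _; rewrite exprn_ge0.
have t1 l : t l <= 1 by rewrite /t; case: ifP => // _; rewrite exprn_ile1//; lra.
have b0 l : 0 <= b l by rewrite mulr_ge0 ?powR_ge0// lp_norm_ge0.
have bB l : (l0 <= l)%N -> b l <= B * t l.
  move=> /H Hl; have pw : 0 < 2 `^ (l%:R * (alpha + 2^-1 - inv_exponent p)) :> R.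
    exact: powR_gt0.
  rewrite /b mulrC -ler_pdivlMr//; apply: lp_norm_le => //.
  by rewrite divr_ge0 ?mulr_ge0 ?powR_ge0.
case: q q1 => [r| |]//=; last first.
  move=> _; apply: ge_ereal_sup => _ [l /= l0l <-]; rewrite lee_fin.
  by rewrite (le_trans (bB _ l0l))// ler_piMr.
rewrite lee_fin => r1; have r0 : 0 < r by lra.
have S : (\sum_(l0 <= l <oo) (b l `^ r)%:E <= (B `^ r)%:E)%E.
  apply: lime_le; first by apply: is_cvg_nneseries => l _ _; rewrite lee_fin powR_ge0.
  apply: nearW => n; rewrite sumEFin lee_fin.
  apply: (@le_trans _ _ (\sum_(l0 <= l < n) B `^ r * t l)).
    apply: ler_sum_nat => l /andP[l0l _].
    apply: (@le_trans _ _ ((B * t l) `^ r)).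
      apply: ge0_ler_powR; rewrite ?nnegrE; [exact: ltW|exact: b0| |exact: bB].
      by rewrite mulr_ge0.
    rewrite powRM// ler_wpM2l ?powR_ge0//.
    have := t0 l; rewrite le_eqVlt => /predU1P[<-|tl0]; first by rewrite powR0// gt_eqF.
    by apply: ge1r_powR; rewrite ?tl0 ?t1.
  rewrite -mulr_sumr ler_piMr ?powR_ge0//.
  apply: le_trans (geometric_decay_sum L n); rewrite -(big_mkord xpredT t).
  have [l0n|nl0] := leqP l0 n; last first.
    by rewrite (big_geq (ltnW nl0)) sumr_ge0.
  by rewrite [leRHS](big_cat_nat (leq0n l0) l0n)/= lerDr sumr_ge0.
rewrite (_ : B%:E = poweR (B `^ r)%:E r^-1)%E.
  apply: gt0_ler_poweR => //; rewrite ?invr_ge0 ?(ltW r0)// in_itv/= leey andbT.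
    by apply: nneseries_ge0 => l _ _; rewrite lee_fin powR_ge0.
  by rewrite lee_fin powR_ge0.
by rewrite poweR_EFin -powRrM divff ?gt_eqF// powRr1.
Qed.

End besov_bounds.

(** * Continuity of the basis functions on [0,1] *)

Section cdv_regularity.
Context (R : realType).
Implicit Types (phi g : R -> R).

Lemma C_class_continuous n g : (0 < n)%N -> C_class n g -> continuous g.
Proof.
move=> n0 [dg _] x; have /derivable1_diffP := dg 0%N x n0.
exact: differentiable_continuous.
Qed.

Lemma compactly_supported_bounded g : continuous g -> compactly_supported g ->
  exists B, 0 < B /\ forall x, `|g x| <= B.
Proof.
move=> cg [K gK]; have cn : continuous (fun x => `|g x|) by move=> x; apply: cvg_norm; exact: cg.
have K0 : - `|K| <= `|K| by rewrite ge0_cp.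
have [c _ cB] := EVT_max K0 (continuous_subspaceT cn).
exists (`|g c| + 1); split; first by rewrite ltr_wpDl.
move=> x; have [->|gx] := eqVneq (g x) 0; first by rewrite normr0 addr_ge0.
rewrite (le_trans (cB x _)) ?lerDl// in_itv/= -ler_norml.
exact: le_trans (gK x gx) (ler_norm K).
Qed.

(** An edge function is prescribed on its half-line only. Replacing it there by a function
    continuous on the whole line makes all products integrable, so that Bessel's inequality can be
    applied. *)
Lemma edge_function_continuous (c s t : R) (D : set R) phi g : continuous phi ->
  edge_function c D phi g ->
  exists u, continuous u /\ forall x, D (s * x + t) -> g (s * x + t) = u x.
Proof.
move=> cphi [M [a ga]].
exists (fun x => \sum_(i < 2 * M) a i * phi (c * s * x + (c * t - (i%:R - M%:R)))).
split; last first.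
  by move=> x /ga ->; apply: eq_bigr => i _; congr (_ * phi _); ring.
apply: continuous_sum_ord => i x; apply: cvgM; first exact: cvg_cst.
exact: continuous_affine.
Qed.

Lemma dilates01_continuous N (c : R) phi g gL gR l k : continuous phi -> continuous g ->
  edge_functions N c phi gL gR -> (k < 2 ^ l)%N ->
  exists u, continuous u /\ forall x, 0 <= x <= 1 -> dilates01 N g gL gR l k x = u x.
Proof.
move=> cphi cg E kl.
suff [u [cu uE]] : exists u, continuous u /\ forall x, 0 <= x <= 1 ->
    (if (k < N)%N then gL k (2 ^+ l * x)
     else if (k < 2 ^ l - N)%N then g (2 ^+ l * x - k%:R)
     else gR (2 ^ l - 1 - k)%N (2 ^+ l * (x - 1))) = u x.
  exists (fun x => Num.sqrt (2 ^+ l) * u x); split; last by move=> x /uE <-.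
  by move=> x; apply: cvgM; [exact: cvg_cst|exact: cu].
have p0 : 0 < 2 ^+ l :> R by rewrite exprn_gt0.
case: ltnP => kN.
  have [EL _ _ _] := E k kN.
  have [u [cu uE]] := edge_function_continuous (2 ^+ l) 0 cphi EL.
  exists u; split=> // x /andP[x0 _]; rewrite -uE ?addr0//=.
  by rewrite in_itv/= andbT mulr_ge0// ltW.
case: ltnP => kNl.
  by exists (fun x => g (2 ^+ l * x - k%:R)); split => //; exact: continuous_affine.
have kR : (2 ^ l - 1 - k < N)%N by lia.
have [_ ER _ _] := E _ kR.
have [u [cu uE]] := edge_function_continuous (2 ^+ l) (- 2 ^+ l) cphi ER.
exists u; split=> // x /andP[_ x1].
have e : 2 ^+ l * (x - 1) = 2 ^+ l * x + - 2 ^+ l by ring.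
rewrite e; apply: uE; rewrite /= in_itv/= -e.
by rewrite mulr_ge0_le0 ?subr_le0// ltW.
Qed.

End cdv_regularity.

Section high_levels.
Context (R : realType) (N : nat) (phi psi : R -> R) (psiL psiR : nat -> R -> R).
Local Notation leb := (@lebesgue_measure R).
Variable hf : 'I_(2 * N) -> R.
Hypotheses (cphi : continuous phi) (cpsi : continuous psi).
Hypothesis sphi : forall x, phi x != 0 -> 1 - N%:R <= x <= N%:R.
Hypothesis ophi : forall k : int, \int[leb]_x (phi x * phi (x - k%:~R)) = (k == 0)%:R.
Hypothesis rphi : forall x, phi x = Num.sqrt 2 *
  \sum_(i < 2 * N) hf i * phi (2 * x - (i%:R - (N%:R - 1))).
Hypothesis rpsi : forall x, psi x = Num.sqrt 2 *
  \sum_(i < 2 * N) (-1) ^+ (i + N.+1) * hf (rev_ord i) *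
    phi (2 * x - (i%:R - (N%:R - 1))).
Hypothesis Epsi : edge_functions N 2 phi psiL psiR.

(* The support of the father function is disjoint from those of the edge functions. *)
Lemma inner01_father_mother (L l k : nat) (k0 : int) (kappa : R) :
  (L <= l)%N -> (k < 2 ^ l)%N -> 3 * N%:R <= k0%:~R :> R ->
  k0%:~R + 3 * N%:R <= 2 ^+ L :> R ->
  inner01 (fun x => kappa * phi (2 ^+ L * x - k0%:~R)) (dilates01 N psi psiL psiR l k) = 0.
Proof.
move=> Ll kl k0l k0r.
have pL : 0 < 2 ^+ L :> R by rewrite exprn_gt0.
have Llr : 2 ^+ L <= 2 ^+ l :> R by rewrite ler_weXn2l// ler1n.
(* The margin [3 N] at both ends keeps the support at least [2 N] units of [2^-L] inside [0,1],
   beyond the reach of the edge functions. *)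
have supp x : phi (2 ^+ L * x - k0%:~R) != 0 ->
    2 * N%:R + 1 <= 2 ^+ L * x /\ 2 ^+ L * x <= 2 ^+ L - 2 * N%:R.
  by move=> /sphi/andP[h1 h2]; split; lra.
have N0 : 0 <= N%:R :> R by [].
have supp01 x : phi (2 ^+ L * x - k0%:~R) != 0 -> 0 <= x <= 1.
  move=> /supp[h1 h2]; apply/andP; split; rewrite -(ler_pM2l pL); lra.
have zero v : (forall x, phi (2 ^+ L * x - k0%:~R) != 0 -> 0 <= x <= 1 -> v x = 0) ->
    inner01 (fun x => kappa * phi (2 ^+ L * x - k0%:~R)) v = 0.
  move=> Z; rewrite /inner01.
  transitivity (\int[leb]_(x in `[0, 1]) (0 : R)).
    apply: eq_Rintegral => x; rewrite inE/= in_itv/= => x01.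
    have [->|/Z ->//] := eqVneq (phi (2 ^+ L * x - k0%:~R)) 0; last by rewrite mulr0.
    by rewrite mulr0 mul0r.
  by rewrite Rintegral_cst ?mul0r//; exact: measurable_itv.
rewrite /dilates01; case: (ltnP k N) => kN.
  apply: zero => x /supp[h1 h2] /andP[x0 x1].
  have [_ _ ZL _] := Epsi kN; rewrite ZL ?mulr0//.
  have := ler_wpM2r x0 Llr; lra.
case: (ltnP k (2 ^ l - N)) => kNl; last first.
  have kR : (2 ^ l - 1 - k < N)%N by lia.
  apply: zero => x /supp[h1 h2] /andP[x0 x1].
  have [_ _ _ ZR] := Epsi kR; rewrite ZR ?mulr0//.
  have x1' : 0 <= 1 - x by rewrite subr_ge0.
  have := ler_wpM2r x1' Llr; lra.
pose d := (l - L)%N.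
have lE : l = (L + d)%N by rewrite /d subnKC.
pose v y := phi (y - k0%:~R) * psi (2 ^+ d * y - k%:R).
have cv : continuous v.
  apply: continuous_mul; first exact: continuous_translate.
  exact: continuous_affine.
have sv : compactly_supported v.
  apply: compactly_supportedM; apply: compactly_supported_translate.
  exact: father_compactly_supported sphi.
have iv := compactly_supported_integrable cv sv.
have ivL : leb.-integrable setT (EFin \o (fun x => v (2 ^+ L * x + 0))).
  apply: compactly_supported_integrable; first exact: continuous_affine.
  exact: compactly_supported_affine.
have v0 : \int[leb]_x v x = 0.
  exact: (father_mother_orthogonal (N := N) cphi sphi ophi rphi rpsi d k0 k cpsi).
(* An interior wavelet remains. The father function is supported in [0,1], so the integral extends
   to the line, where scaling by [2 ^+ L] leads to [father_mother_orthogonal]. *)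
rewrite /inner01 Rintegral_mkcond.
transitivity (\int[leb]_x (kappa * Num.sqrt (2 ^+ l) * v (2 ^+ L * x + 0))).
  apply: eq_Rintegral => x _; rewrite patchE addr0; case: ifPn => x01.
    have e : 2 ^+ d * (2 ^+ L * x) = 2 ^+ l * x by rewrite lE addnC exprD mulrA.
    by rewrite /v e; ring.
  have [e|/supp01 h] := eqVneq (phi (2 ^+ L * x - k0%:~R)) 0.
    by rewrite /v e mul0r mulr0.
  by move: x01; rewrite notin_setE/= in_itv/= h.
by rewrite RintegralZl// Rintegral_affine// v0 !mulr0.
Qed.

End high_levels.

(** * The alternative hypothesis *)

Section wavelet_bump.
Context (R : realType).
Local Notation leb := (@lebesgue_measure R).

Lemma inner01_sqr_le (f : {mfun R >-> R}) (a b c : R) : 0 <= a -> 0 <= b ->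
  (forall x, `|f x| <= a) -> (forall x, f x != 0 -> c <= x <= c + b) ->
  inner01 f f <= a ^+ 2 * b.
Proof.
move=> a0 b0 fa fc.
have mf : measurable_fun setT (f : measurableTypeR R -> R) by exact: (measurable_funPT f).
have -> : inner01 f f = \int[uniform_prob (@ltr01 R)]_x (f x ^+ 2).
  rewrite /Rintegral integral_uniform; last 2 first.
  - exact/measurable_EFinP/measurable_funX.
  - by move=> x; rewrite lee_fin sqr_ge0.
  by rewrite subr0 invr1 mul1e; congr fine.
apply: (mean_uniform_bump (c := c)) => //.
- exact: measurable_funX.
- exact: sqr_ge0.
- move=> x; rewrite sqr_ge0 -real_normK ?num_real// lerXn2r ?nnegrE//.
- by move=> x; rewrite sqrf_eq0 => /fc.
Qed.

Lemma pow2_unbounded (B : R) : exists n : nat, B <= 2 ^+ n.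
Proof.
exists (Num.truncn `|B|).+1; rewrite (le_trans (ler_norm B))//.
have := truncnS_gt `|B|; move=> /ltW/le_trans; apply.
by rewrite -natrX ler_nat ltnW// ltn_expl.
Qed.

Lemma powR_half (L : nat) (r : R) : (2^-1 ^+ L) `^ r = 2 `^ (- (L%:R * r)).
Proof.
rewrite -powR_mulrn ?invr_ge0// -powR_inv1// -!powRrM; congr powR; ring.
Qed.

Variables (alpha nu radius : R) (p q : \bar R) (A l0 : nat) (w : nat -> nat -> R -> R).
Variable x0 : R.
Hypotheses (hp : (2%:E <= p)%E) (hq : (1%:E <= q)%E).
Hypotheses (hnu : nu = alpha - inv_exponent p) (hnu2 : 2^-1 < nu).
Hypotheses (hradius : 0 < radius) (A0 : (0 < A)%N) (hw : cdv_basis A l0 w).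
Hypothesis hx0 : 0 < x0 < 1.

(** The constants must not depend on [L], because the bandwidth will follow [D]. A single [M] bounds
    both amplitude and width. *)
Lemma wavelet_bump : exists (c0 M : R) (L0 : nat), 0 < c0 /\ 0 < M /\
  forall L, (L0 <= L)%N -> exists f : {mfun R >-> R},
    [/\ besov_ball alpha p q radius l0 w f,
        c0 * (2^-1 ^+ L) `^ nu <= `|f x0|,
        forall x, `|f x| <= M * (2^-1 ^+ L) `^ nu,
        (M * (2^-1 ^+ L) `^ nu) ^+ 2 <= 2^-1 &
        exists c, forall x, f x != 0 -> c <= x <= c + M * 2^-1 ^+ L].
Proof.
case: hw => N [phi [psi [phiL [phiR [psiL [psiR]]]]]].
move=> [[AN N2 Cphi Cpsi [sphi _ [iphi ophi] [hf [rphi rpsi]] _]] [Ephi Epsi] [wf wm] _ [ow _]].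
have cphi := C_class_continuous A0 Cphi.
have cpsi := C_class_continuous A0 Cpsi.
have N0 : 0 < N%:R :> R by rewrite ltr0n (leq_trans A0).
have [Phi [Phi0 phiB]] := compactly_supported_bounded cphi (father_compactly_supported sphi).
have [c1 [c10 phic]] := father_lower_bound cphi sphi iphi rphi.
(* With this amplitude, [(kappa Phi)^2] times the support length [2 N] is [radius^2 / (2 N)], hence
   at most [radius^2]. *)
pose kappa := radius / (Phi * (2 * N%:R)).
have kappa0 : 0 < kappa by rewrite divr_gt0 ?mulr_gt0.
pose M := kappa * Phi + 2 * N%:R.
have kP0 : 0 < kappa * Phi by rewrite mulr_gt0.
have M0 : 0 < M by rewrite addr_gt0// mulr_gt0.
have [x00 x01] := andP hx0.
(* The first two terms put [x0] at distance at least [4 N 2^-L] from both endpoints; the third makes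
   the squared amplitude at most [1/2]. *)
have [n hn] := pow2_unbounded (4 * N%:R / x0 + 4 * N%:R / (1 - x0) + 2 * M ^+ 2).
exists (kappa * c1), M, (maxn l0.+1 n); split; first by rewrite mulr_gt0.
split=> // L; rewrite geq_max => /andP[l0L nL].
set h := 2^-1 ^+ L.
have p2 : 0 < 2 ^+ L :> R by rewrite exprn_gt0.
have hE : h = (2 ^+ L)^-1 by rewrite /h exprVn.
have h0 : 0 < h by rewrite hE invr_gt0.
have h1 : h <= 1 by rewrite /h exprn_ile1//; lra.
have hnu0 : 0 < h `^ nu by exact: powR_gt0.
have big : 4 * N%:R / x0 + 4 * N%:R / (1 - x0) + 2 * M ^+ 2 <= 2 ^+ L.
  by rewrite (le_trans hn)// ler_weXn2l// ler1n.
have t1 : 0 <= 4 * N%:R / x0 by rewrite divr_ge0 ?mulr_ge0 ?(ltW x00) ?(ltW N0).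
have x0' : 0 < 1 - x0 by rewrite subr_gt0.
have t2 : 0 <= 4 * N%:R / (1 - x0) by rewrite divr_ge0 ?mulr_ge0 ?(ltW x0') ?(ltW N0).
have t3 : 0 <= 2 * M ^+ 2 by rewrite mulr_ge0 ?sqr_ge0.
have b1 : 4 * N%:R <= 2 ^+ L * x0 by rewrite -ler_pdivrMr//; lra.
have b2 : 4 * N%:R <= 2 ^+ L * (1 - x0) by rewrite -ler_pdivrMr//; lra.
have b3 : 2 * M ^+ 2 <= 2 ^+ L by lra.
have [k0 hk0] := phic (2 ^+ L * x0).
have phik0 : phi (2 ^+ L * x0 - k0%:~R) != 0 by rewrite -normr_gt0 (lt_le_trans c10).
have /andP[s1 s2] := sphi _ phik0.
(* As [phi] does not vanish at [2^L x0 - k0], the integer [k0] is within [N] of [2^L x0]; of the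
   distance [4 N], at least [3 N] is left. *)
have k0l : 3 * N%:R <= k0%:~R :> R by lra.
have k0r : k0%:~R + 3 * N%:R <= 2 ^+ L :> R by lra.
pose f0 x : R := kappa * h `^ nu * phi (2 ^+ L * x - k0%:~R).
have cf : continuous f0.
  by move=> x; apply: cvgM; [exact: cvg_cst|exact: continuous_affine].
have mf0 : measurable_fun setT f0 by exact: continuous_measurable_fun.
pose f : {mfun R >-> R} := HB.pack f0 (isMeasurableFun.Build _ _ _ _ f0 mf0).
have kh0 : 0 < kappa * h `^ nu by rewrite mulr_gt0.
have fa x : `|f x| <= kappa * Phi * h `^ nu.
  rewrite /= /f0 normrM (gtr0_norm kh0) [leRHS]mulrAC ler_wpM2l ?phiB//.
  exact: ltW.
have fs x : f x != 0 -> (k0%:~R + 1 - N%:R) * h <= x <= (k0%:~R + 1 - N%:R) * h + 2 * N%:R * h.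
  rewrite /= /f0 mulf_eq0 negb_or => /andP[_ /sphi/andP[u1 u2]].
  have ex : x = 2 ^+ L * x * h by rewrite hE mulrAC divff ?mul1r// gt_eqF.
  rewrite -mulrDl; apply/andP; split.
    by rewrite [leRHS]ex ler_wpM2r ?(ltW h0)//; lra.
  by rewrite [leLHS]ex ler_wpM2r ?(ltW h0)//; lra.
have hnu' : nu + 2^-1 = alpha + 2^-1 - inv_exponent p by rewrite hnu; lra.
have Mh : M ^+ 2 * (h `^ nu) ^+ 2 <= 2^-1.
  have hh : (h `^ nu) ^+ 2 <= h.
    have nn : 1 <= nu + nu by have hn2 := hnu2; lra.
    rewrite expr2 -powRD ?(gt_eqF h0) ?implybT// -{2}(powRr1 (ltW h0)).
    by apply: ger_powR => //; rewrite h0.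
  apply: (le_trans (ler_wpM2l (sqr_ge0 M) hh)).
  by rewrite hE ler_pdivrMr//; lra.
have fmass : inner01 f f <= (radius * h `^ nu) ^+ 2 * h.
  apply: (le_trans (inner01_sqr_le _ _ fa fs)).
  - by rewrite mulr_ge0 ?(ltW hnu0)// ltW.
  - by rewrite mulr_ge0 ?(ltW h0)// mulr_ge0 ?(ltW N0).
  rewrite (_ : _ * (2 * N%:R * h) = (radius * h `^ nu) ^+ 2 * h * (2 * N%:R)^-1); last first.
    by rewrite /kappa; field; rewrite !gt_eqF.
  apply: ler_piMr; first by rewrite mulr_ge0 ?sqr_ge0 ?(ltW h0).
  rewrite invf_le1 ?mulr_gt0// -natrM ler1n muln_gt0.
  exact: leq_trans A0 AN.
have rep l k : (l0 <= l)%N -> (k < level_size l0 l)%N ->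
    exists u, continuous u /\ forall x, 0 <= x <= 1 -> w l k x = u x.
  rewrite /level_size; case: eqVneq => [->|ll0] l0l' kl.
    have [u [cu uE]] := dilates01_continuous cphi cphi Ephi kl.
    by exists u; split=> // x x01'; rewrite wf// uE.
  have l0l : (l0 < l)%N by rewrite ltn_neqAle eq_sym ll0.
  have [u [cu uE]] := dilates01_continuous cphi cpsi Epsi kl.
  by exists u; split=> // x x01'; rewrite wm// uE.
exists f; split.
- split.
  + exact: continuous_subspaceT.
  + split; first exact: measurable_funTS.
    apply: (@continuous_integrable01 _ (fun x => f0 x ^+ 2)).
    move=> x; rewrite /GRing.exp/=; apply: cvgM; exact: cf.
  + apply: (@besov_norm_le R alpha radius p q l0 L w f hp hq (ltW hradius)) => l l0l.
    case: ltnP => lL.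
      apply: (@le_trans _ _ (inner01 f f)).
        have /choice[u uE] (k : 'I_(level_size l0 l)) :
            exists u, continuous u /\ forall x, 0 <= x <= 1 -> w l k x = u x.
          exact: rep.
        have -> : \sum_(k < level_size l0 l) inner01 f (w l k) ^+ 2 =
            \sum_(k < level_size l0 l) inner01 f (u k) ^+ 2.
          apply: eq_bigr => k _; congr (_ ^+ 2).
          by apply: inner01_eq => // x x01'; exact: (uE k).2.
        apply: bessel_inequality => //; first by move=> k; exact: (uE k).1.
        move=> i j; rewrite -(inner01_eq (uE i).2 (uE j).2) ow//.
        by rewrite eqxx.
      apply: (le_trans fmass).
      have half2 n' : 2^-1 ^+ n' = 2 `^ (- n'%:R) :> R by rewrite powRN powR_mulrn// exprVn.
      have two0 : (2 : R) != 0 by [].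
      rewrite -hnu'; set X := 2 `^ _.
      have X0 : 0 < X by exact: powR_gt0.
      rewrite (_ : _ * h = radius ^+ 2 * ((h `^ nu) ^+ 2 * h)); last by ring.
      rewrite [leRHS](_ : _ = radius ^+ 2 * ((2^-1 ^+ (L - l)) ^+ 2 / X ^+ 2)); last first.
        by field; rewrite gt_eqF.
      rewrite ler_wpM2l ?sqr_ge0// ler_pdivlMr ?exprn_gt0//.
      rewrite /h powR_half !half2 /X !expr2 -!powRD ?two0 ?implybT//.
      apply: ler_powR; first by rewrite ler1n.
      rewrite natrB ?(ltnW lL)//.
      (* Here [nu > 1/2] enters: the weight [2^(l (nu + 1/2))] against the mass leaves
         [2^(-(L - l)(nu + 1/2))], which must be at most [2^-(L - l)]. *)
      have : 0 <= (L%:R - l%:R) * (2 * nu - 1) :> R.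
        have hn2 := hnu2.
        by rewrite mulr_ge0 ?subr_ge0 ?ler_nat ?(ltnW lL)//; lra.
      lra.
    rewrite mulr0 mul0r expr0n/= big1// => k _.
    have l0l' : (l0 < l)%N by exact: leq_trans l0L lL.
    have kl : (k < 2 ^ l)%N.
      by rewrite (leq_trans (ltn_ord k))// /level_size gtn_eqF.
    have -> : inner01 f (w l k) = inner01 f (dilates01 N psi psiL psiR l k).
      by apply: inner01_eq => // x x01'; rewrite wm.
    by rewrite (inner01_father_mother cphi cpsi sphi ophi rphi rpsi Epsi) ?expr0n.
- by rewrite /= /f0 normrM (gtr0_norm kh0) mulrAC ler_wpM2l// ltW.
- move=> x; apply: (le_trans (fa x)); rewrite ler_wpM2r ?(ltW hnu0)// lerDl; lra.
- by rewrite exprMn.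
- exists ((k0%:~R + 1 - N%:R) * h) => x /fs/andP[-> h2]; apply: (le_trans h2).
  by rewrite lerD2l ler_wpM2r ?(ltW h0)// lerDr ltW.
Qed.

End wavelet_bump.

(** * The lower bound *)

Lemma inv_exponent_ge0 (R : realType) (p : \bar R) : (2%:E <= p)%E -> 0 <= inv_exponent p.
Proof. by case: p => [r| |]//=; rewrite lee_fin => r2; rewrite invr_ge0; lra. Qed.

Lemma besov_ball_zero (R : realType) (alpha radius : R) (p q : \bar R) l0 w
    (f : {mfun R >-> R}) : (2%:E <= p)%E -> (1%:E <= q)%E -> 0 <= radius ->
  (forall x, f x = 0) -> besov_ball alpha p q radius l0 w f.
Proof.
move=> p2 q1 radius0 f0; have fE : (f : R -> R) = fun=> 0 by apply/funext.
have cf : continuous (f : R -> R) by rewrite fE => x; exact: cvg_cst.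
split; first exact: continuous_subspaceT.
  split; first exact: (measurable_funTS (measurable_funPT f)).
  apply: (@continuous_integrable01 _ (fun x => f x ^+ 2)).
  by move=> x; rewrite fE; under eq_fun do rewrite expr0n; exact: cvg_cst.
apply: (besov_norm_le (L := 0%N)) => // l _; rewrite big1 ?sqr_ge0// => k _.
have -> : inner01 f (w l k) = \int[@lebesgue_measure R]_(x in `[0, 1]) (0 : R).
  by apply: eq_Rintegral => x _; rewrite f0 mul0r.
by rewrite Rintegral_cst ?mul0r ?expr0n//; exact: measurable_itv.
Qed.

(** Take the least admissible [L]: if it exceeds [L0], its predecessor fails, that is
    [2^(L - 1) < D]. *)
Lemma dyadic_scale (R : realType) (D : R) (L0 : nat) : exists L : nat,
  [/\ (L0 <= L)%N, D <= 2 ^+ L & L = L0 \/ 2 ^+ L <= 2 * D].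
Proof.
have exL : exists L, (L0 <= L)%N && (D <= 2 ^+ L).
  have [n Dn] := pow2_unbounded D; exists (maxn L0 n); rewrite leq_maxl/=.
  by rewrite (le_trans Dn)// ler_weXn2l ?ler1n// leq_maxr.
case: (ex_minnP exL) => L /andP[L0L DL] minL; exists L; split => //.
move: L0L; rewrite leq_eqVlt => /predU1P[->|]; first by left.
case: L DL minL => // L DL minL; rewrite ltnS => L0L; right.
rewrite exprS ler_wpM2l// ltW// ltNge; apply/negP => DL'.
by have := minL L; rewrite L0L DL' => /(_ isT); rewrite ltnn.
Qed.

(** Rounding to a dyadic bandwidth costs at most [2^(2 nu)]. If the bandwidth stays at [2^-L0], the
    right-hand side is at least 1, and the minimum with 1 takes over. *)
Lemma bandwidth_rate (R : realType) (nu D : R) (L L0 : nat) : 0 < nu -> 0 < D ->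
  L = L0 \/ 2 ^+ L <= 2 * D ->
  Num.min (D `^ (- (2 * nu))) 1 <=
    2 `^ (2 * nu * L0.+1%:R) * ((2^-1 ^+ L) `^ nu) ^+ 2.
Proof.
move=> nu0 D0 LD.
have -> : ((2^-1 ^+ L) `^ nu) ^+ 2 = (2 ^+ L) `^ (- (2 * nu)) :> R.
  rewrite powR_half expr2 -powRD ?implybT//; last by rewrite pnatr_eq0 implybT.
  by rewrite -powR_mulrn// -powRrM; congr powR; ring.
case: LD => [->|LD].
  rewrite ge_min; apply/orP; right; rewrite -powR_mulrn// -powRrM -powRD.
    rewrite -natr1 (_ : 2 * nu * _ + _ = 2 * nu); last by ring.
    by rewrite -[leLHS](powRr0 2); apply: ler_powR; rewrite ?ler1n// mulr_ge0// ltW.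
  by rewrite pnatr_eq0 implybT.
rewrite ge_min; apply/orP; left; rewrite powRN [in leRHS]powRN.
rewrite ler_pdivlMr ?powR_gt0// ?exprn_gt0// ler_pdivrMl ?powR_gt0//.
apply: (@le_trans _ _ ((2 * D) `^ (2 * nu))).
  by apply: ge0_ler_powR; rewrite ?nnegrE ?exprn_ge0// ?mulr_ge0// ltW.
rewrite powRM ?(ltW D0)// mulrC ler_wpM2l ?powR_ge0//; apply: ler_powR; first by rewrite ler1n.
by rewrite ler_peMr ?ler1n// mulr_ge0// ltW.
Qed.

Theorem theorem4p4 (R : realType) (alpha nu radius Ceps : R) (p q : \bar R)
    (A l0 : nat) (w : nat -> nat -> R -> R) (x0 : R)
    (hp : (2%:E <= p)%E) (hq : (1%:E <= q)%E)
    (hnu : nu = alpha - inv_exponent p) (hnu2 : 2^-1 < nu)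
    (hradius : 0 < radius) (hCeps : 0 < Ceps)
    (hA : alpha < A%:R) (hw : cdv_basis A l0 w)
    (hx0 : 0 < x0 < 1) :
  exists C : R, 0 < C /\
  forall (S : nat -> design R) (D : nat -> R),
    (forall t (j : 'I_(servers (S t))), 0 < eps j <= Ceps) ->
    (forall t (j : 'I_(servers (S t))), 0 <= delta j) ->
    ((total_obs (S t))%:R : R) @[t --> \oo] --> +oo ->
    (\sum_(j < servers (S t)) (nobs j)%:R * delta j) @[t --> \oo] --> 0 ->
    (forall t, 0 < D t /\
       D t `^ (2 * nu + 2) =
       \sum_(j < servers (S t))
         Num.min ((nobs j)%:R ^+ 2 * eps j ^+ 2) ((nobs j)%:R * D t)) ->
    (\forall t \near \oo,
       ((Num.min (D t `^ (- (2 * nu))) 1)%:E <=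
        C%:E * minimax_risk (S t) (besov_ball alpha p q radius l0 w) x0)%E) /\
    (forall t,
       let V := \sum_(j < servers (S t)) (nobs j)%:R ^+ 2 * eps j ^+ 2 in
       \big[Num.max/0]_(j < servers (S t)) ((nobs j)%:R * eps j ^+ 2) <=
         V `^ (2 * nu + 2)^-1 ->
       Num.min (V `^ (- (2 * nu) / (2 * nu + 2))) 1 <=
         Num.min (D t `^ (- (2 * nu))) 1).
Proof.
have nu0 : 0 < nu by lra.
have A0 : (0 < A)%N.
  by rewrite -(ltr_nat R); have := inv_exponent_ge0 hp; lra.
have [c0 [M [L0 [c00 [M0 bump]]]]] := wavelet_bump hp hq hnu hnu2 hradius A0 hw hx0.
pose Y := 4 * M ^+ 2 * expR Ceps.
pose W := expR (2 * Y) * Y ^+ 2 + 2 * M ^+ 3.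
pose K : R := 2 `^ (2 * nu * L0.+1%:R).
have K0 : 0 < K by exact: powR_gt0.
(* [K] pays for the dyadic and capped bandwidth, the other factor for the two-point bound with
   amplitude [c0 h^nu] at [x0]. *)
pose C := K * (64 * expR W / c0 ^+ 2).
have eW : 0 < expR W := expR_gt0 W.
have C0 : 0 < C by rewrite mulr_gt0// divr_gt0 ?exprn_gt0 ?mulr_gt0.
exists C; split => // S D heps hdelta _ hsum hD; split; last first.
  move=> t V _; have [Dt0 Dt] := hD t.
  (* Each minimum is at most its first argument, so [V] dominates [D^(2 nu + 2)]; a negative power
     reverses this. *)
  have VD : D t `^ (2 * nu + 2) <= V.
    by rewrite Dt; apply: ler_sum => j _; rewrite ge_min lexx.
  have e0 : 0 < 2 * nu + 2 by lra.
  have V0 : 0 < V by apply: lt_le_trans VD; exact: powR_gt0.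
  rewrite le_min !ge_min lexx !orbT andbT; apply/orP; left.
  rewrite mulNr !powRN lef_pV2 ?posrE ?powR_gt0//.
  have -> : D t `^ (2 * nu) = (D t `^ (2 * nu + 2)) `^ (2 * nu / (2 * nu + 2)).
    by rewrite -powRrM; congr powR; field; rewrite gt_eqF.
  apply: ge0_ler_powR; rewrite ?nnegrE ?powR_ge0 ?(ltW V0)//.
  by rewrite divr_ge0 ?(ltW e0)// mulr_ge0 ?(ltW nu0).
pose k := 8 * expR Y * M ^+ 2.
have k0 : 0 < k by rewrite !mulr_gt0 ?expR_gt0 ?exprn_gt0.
have [f0 f0E] : exists f0 : {mfun R >-> R}, forall x, f0 x = 0.
  pose z (_ : R) : R := 0.
  have mz : measurable_fun setT z by exact: measurable_cst.
  pose f0 : {mfun R >-> R} := HB.pack z (isMeasurableFun.Build _ _ _ _ z mz).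
  by exists f0.
have x01 : 0 <= x0 <= 1 by have /andP[h1 h2] := hx0; rewrite !ltW.
near=> t.
have small : k * (\sum_(j < servers (S t)) (nobs j)%:R * delta j) <= 4^-1.
  have : `|0 - \sum_(j < servers (S t)) (nobs j)%:R * delta j| <= 4^-1 / k.
    near: t; apply: (cvgrPdist_le _ _).1 => //.
    by rewrite divr_gt0.
  rewrite sub0r normrN => /(le_trans (ler_norm _)).
  by rewrite ler_pdivlMr// mulrC.
have [Dt0 Dt] := hD t.
have [L [L0L DL LD]] := dyadic_scale (D t) L0.
have [g [gball gx0 ga g2 [c gc]]] := bump L L0L.
set h := 2^-1 ^+ L in gx0 ga g2 gc.
have p2 : 0 < 2 ^+ L :> R by rewrite exprn_gt0.
have hE : h = (2 ^+ L)^-1 by rewrite /h exprVn.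
have h01 : 0 < h <= 1 by rewrite hE invr_gt0 p2 invf_le1// exprn_ege1// ler1n.
have Dh : D t * h <= 1 by rewrite hE ler_pdivrMr// mul1r.
have rate := bandwidth_rate nu0 Dt0 LD.
have risk_ge : ((c0 ^+ 2 * (h `^ nu) ^+ 2 / (64 * expR W))%:E <=
    minimax_risk (S t) (besov_ball alpha p q radius l0 w) x0)%E.
  apply: le_ereal_inf_tmp => _ [P ->].
  have lb : ((c0 ^+ 2 * (h `^ nu) ^+ 2 / (64 * expR W))%:E <=
      (g x0 ^+ 2 / (64 * expR W))%:E)%E.
    rewrite lee_fin ler_wpM2r ?invr_ge0 ?mulr_ge0 ?(ltW eW)//.
    rewrite -exprMn -[leRHS]real_normK ?num_real// lerXn2r ?nnegrE//.
    by rewrite mulr_ge0 ?powR_ge0 ?(ltW c00).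
  apply: (le_trans lb).
  (* Both hypotheses lie in the Besov ball, so whichever has the large risk bounds the supremum from
     below. *)
  have [H|H] := risk_lower_bound_bandwidth P f0E M0 nu0 h01 g2 ga gc x01 (heps t)
    (hdelta t) Dt0 Dh Dt small; apply: (le_trans H); apply: ereal_sup_ubound.
    by exists f0 => //; apply: besov_ball_zero => //; exact: ltW.
  by exists g.
have C0E : (0 <= C%:E)%E by rewrite lee_fin ltW.
apply: le_trans (lee_wpmul2l C0E risk_ge); rewrite -EFinM lee_fin.
apply: (le_trans rate); rewrite -/K -/h /C.
rewrite (_ : K * _ * _ = K * (h `^ nu) ^+ 2)//; field.
by rewrite !gt_eqF.
Unshelve. all: by end_near. Qed.
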